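(* Let $T=(T_1,\ldots,T_n)\in B(\mathcal H)^n$. If $T$ is not a nilpotent $n$-tuple of operators, then there exists an injective weighted left multi-shift $W=(W_1,\ldots,W_n)$, with weight sequence $\boldsymbol\mu$, having the following properties: (i) $\big\|\sum_{|\alpha|=k}W_\alpha W_\alpha^*\big\|^{1/2}\le(k+1)\big\|\sum_{|\alpha|=k}T_\alpha T_\alpha^*\big\|^{1/2}$ for any $k\in\mathbb N$; (ii) $r(W)=r(T)$; (iii) $(T_1,\ldots,T_n)$ is jointly similar to $(P_{\mathcal M}(W_1\otimes I_{\mathcal H})|_{\mathcal M},\ldots,P_{\mathcal M}(W_n\otimes I_{\mathcal H})|_{\mathcal M})$, where $\mathcal M\subset F^2(H_n)\otimes\mathcal H$ is a joint invariant (closed) subspace under the operators $W_i^*\otimes I_{\mathcal H}$, $i\in\{1,\ldots,n\}$; (iv) $r(p(T_1,\ldots,T_n))\le r(p(W_1,\ldots,W_n))$ for every noncommutative polynomial $p$, and the map $\Phi_T:\mathcal A(\boldsymbol\mu)\to B(\mathcal H)$ defined by $\Phi_T(p(W_1,\ldots,W_n)):=p(T_1,\ldots,T_n)$ is completely bounded with $\|\Phi_T\|_{cb}\le\frac{\pi}{\sqrt6}$. If $T$ is a nilpotent $n$-tuple of index $m\ge2$, then there is a truncated weighted left multi-shift $W=(W_1,\ldots,W_n)$ which is nilpotent of index $m$ such that all of (i)–(iv) hold and $$\|\Phi_T\|_{cb}\le\sqrt{\sum_{k=0}^{m-1}\frac1{(k+1)^2}}.$$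
   Context: Let $n\ge 1$ and let $\mathbb F_n^+$ be the unital free semigroup on generators $g_1,\ldots,g_n$ with identity $g_0$; $|\alpha|$ is the length of $\alpha$. $F^2(H_n)$ is the full Fock space, a Hilbert space with orthonormal basis $\{e_\alpha\}_{\alpha\in\mathbb F_n^+}$. For operators $T_1,\ldots,T_n$, $T_\alpha:=T_{i_1}\cdots T_{i_k}$ if $\alpha=g_{i_1}\cdots g_{i_k}$, $T_{g_0}:=I$. The weighted left multi-shift associated with weights $\boldsymbol\mu=\{\mu_\beta\}_{|\beta|\ge1}$, $\mu_\beta\ge0$, with $\sup_\alpha\mu_{g_i\alpha}<\infty$ for each $i$, is $W_ie_\alpha=\mu_{g_i\alpha}e_{g_i\alpha}$; it is injective if all $\mu_\beta>0$. It is truncated if its weights are obtained from those of an injective weighted left multi-shift by replacing with $0$ all weights $\mu_\beta$ with $\beta\in\Omega:=\{\alpha\gamma:\gamma\in\Lambda,\alpha\in\mathbb F_n^+\}$ for some $\Lambda\subset\mathbb F_n^+\setminus\{g_0\}$. An $n$-tuple $T$ is nilpotent if there is $m\in\mathbb N$ with $T_\alpha=0$ for all $|\alpha|=m$; the smallest such $m$ is its index. The joint spectral radius of an $n$-tuple is $r(T):=\lim_{k\to\infty}\|\sum_{|\alpha|=k}T_\alpha T_\alpha^*\|^{1/2k}$; for a single operator, $r$ is the usual spectral radius. $\mathcal A(\boldsymbol\mu)$ is the norm-closed algebra generated by $W_1,\ldots,W_n$ and the identity; $\Phi_T$ is defined on polynomials and extended by continuity. $T\in B(\mathcal H)^n$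 is jointly similar to $A\in B(\mathcal K)^n$ if there is an invertible $X:\mathcal H\to\mathcal K$ with $T_i=X^{-1}A_iX$ for all $i$. *)

(* Defs.v *)
From HB Require Import structures.
From mathcomp Require Import all_boot all_order all_algebra.
From mathcomp Require Import finmap complex.
From mathcomp Require Import all_classical all_reals all_analysis.
(* The notations of monalg clash with those of mathcomp-analysis. *)
From mathcomp Require Import -(notations) monalg.

Set Implicit Arguments.
Unset Strict Implicit.
Unset Printing Implicit Defensive.

Import Order.TTheory GRing.Theory Num.Theory.
Import numFieldNormedType.Exports.

Local Open Scope classical_set_scope.
Local Open Scope ring_scope.
Local Open Scope complex_scope.

(* Complex Hilbert spaces: the inner product is linear in its first argument. *)

HB.mixin Record isHilbert (R : realType) (H : Type)
    of CompleteNormedModule R[i] H := {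
  hdot : {dot H for (@Num.conj R[i])};
  hdotE : forall x : H, hdot x x = `|x| ^+ 2
}.

#[short(type="hilbertType")]
HB.structure Definition Hilbert (R : realType) :=
  {H of isHilbert R H & CompleteNormedModule R[i] H}.

(* The norm of a normed R[i]-module takes its values in R[i]; [rnorm] is the
   same number as an element of R. *)
Definition rnorm (R : realType) (V : normedZmodType R[i]) (x : V) : R :=
  complex.Re `|x|.

Section BoundedOperators.
Variable R : realType.
Implicit Types U V : normedModType R[i].

Definition bounded_op U V (f : U -> V) : Prop := linear f /\ continuous f.

Definition opnorm U V (f : U -> V) : R :=
  sup [set rnorm (f x) | x in [set x | rnorm x <= 1]].

(* The norm of the direct sum of k copies of V. *)
Definition vecnorm V k (x : 'I_k -> V) : R :=
  Num.sqrt (\sum_i rnorm (x i) ^+ 2).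

(* The operator norm of the operator matrix A acting from U^k to V^k. *)
Definition mxopnorm U V k (A : 'I_k -> 'I_k -> U -> V) : R :=
  sup [set vecnorm (fun i => \sum_j A i j (x j)) | x in
       [set x : 'I_k -> U | vecnorm x <= 1]].

Definition spectrum U (A : U -> U) : set R[i] :=
  [set a | ~ exists B : U -> U, [/\ bounded_op B,
     B \o (a *: id - A) = id & (a *: id - A) \o B = id]].

Definition spectral_radius U (A : U -> U) : R :=
  sup [set rnorm a | a in spectrum A].

Definition lspan U (S : set U) : set U :=
  [set x | exists (k : nat) (a : 'I_k -> R[i]) (y : 'I_k -> U),
     (forall i, S (y i)) /\ x = \sum_i a i *: y i].

(* Norm-closed subalgebras of B(U). *)
Definition closed_subalgebra U (S : set (U -> U)) : Prop :=
  [/\ S `<=` [set A | bounded_op A],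
      (forall (a : R[i]) A B, S A -> S B -> S (a *: A + B)),
      (forall A B, S A -> S B -> S (A \o B)) &
      (forall A, bounded_op A ->
         (forall eps : R, 0 < eps -> exists2 B, S B & opnorm (A - B) < eps) ->
         S A)].

(* The norm of Phi, restricted to S, as a completely bounded map: the supremum
   over all k of the norms of the maps Phi_k acting entrywise on the k x k
   matrices over S. *)
Definition cb_norm U V (S : set (U -> U)) (Phi : (U -> U) -> (V -> V)) :
    \bar R :=
  ereal_sup [set y | exists (k : nat) (A : 'I_k -> 'I_k -> U -> U),
    [/\ (forall i j, S (A i j)), mxopnorm A <= 1 &
        y = (mxopnorm (fun i j => Phi (A i j)))%:E]].

Definition completely_bounded U V (S : set (U -> U))
    (Phi : (U -> U) -> (V -> V)) : Prop :=
  (forall (a : R[i]) A B, S A -> S B ->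
     Phi (a *: A + B) = a *: Phi A + Phi B) /\
  (cb_norm S Phi < +oo)%E.

Definition jointly_similar U V n (T : 'I_n -> U -> U) (A : 'I_n -> V -> V) :
    Prop :=
  exists (X : U -> V) (Xinv : V -> U),
    [/\ bounded_op X, bounded_op Xinv, Xinv \o X = id, X \o Xinv = id &
        forall i, T i = Xinv \o A i \o X].

(* Closed subspaces, as normed spaces in their own right. *)

Record closed_subspace U := ClosedSubspace {
  csset : set U;
  _ : csset 0;
  _ : forall (a : R[i]) x y, csset x -> csset y -> csset (a *: x + y);
  _ : closed csset }.

Definition csmem U (M : closed_subspace U) : {pred U} := fun x => x \in csset M.

Record csub U (M : closed_subspace U) :=
  CSub { csval : U; csvalP : csval \in csmem M }.

End BoundedOperators.

Section ClosedSubspaceNormed.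
Variables (R : realType) (U : normedModType R[i]) (M : closed_subspace U).

HB.instance Definition _ := [isSub for @csval R U M].
HB.instance Definition _ := [Choice of csub M by <:].

Fact csmem_submod_closed : submod_closed (csmem M).
Proof.
case: M => S S0 SD Sc; split; first by rewrite /csmem unfold_in /= inE.
by move=> a x y; rewrite /csmem !unfold_in /= !inE; exact: SD.
Qed.

HB.instance Definition _ :=
  GRing.isSubmodClosed.Build R[i] U (csmem M) csmem_submod_closed.
HB.instance Definition _ := [SubChoice_isSubLmodule of csub M by <:].

Let norm (x : csub M) : R[i] := `|csval x|.

Let norm_triangle x y : norm (x + y) <= norm x + norm y.
Proof. exact: ler_normD. Qed.

Let normZ (a : R[i]) x : norm (a *: x) = `|a| * norm x.
Proof. exact: normrZ. Qed.

Let norm_eq0 x : norm x = 0 -> x = 0.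
Proof. by move=> /normr0_eq0 x0; exact: val_inj. Qed.

HB.instance Definition _ :=
  Lmodule_isNormed.Build R[i] (csub M) norm_triangle normZ norm_eq0.

End ClosedSubspaceNormed.

Section HilbertSpaces.
Variable R : realType.
Implicit Types F H K : hilbertType R.

Definition adjoint H K (A : H -> K) : K -> H :=
  get [set B : K -> H | forall x y, hdot (A x) y = hdot x (B y)].

Definition orthproj K (M : closed_subspace K) (x : K) : csub M :=
  get [set y : csub M | forall z, csset M z -> hdot (x - csval y) z = 0].

(* The compression P_M A|_M. *)
Definition compression K (M : closed_subspace K) (A : K -> K) :
    csub M -> csub M :=
  fun y => orthproj M (A (csval y)).

Definition orthonormal_basis (I : eqType) F (e : I -> F) : Prop :=
  (forall a b, hdot (e a) (e b) = (a == b)%:R) /\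
  closure (lspan (range e)) = setT.

(* (K, tens) is the Hilbert space tensor product of F and H. *)
Definition hilbert_tensor F H K (tens : {bilinear F -> H -> K}) : Prop :=
  (forall x x' h h',
     hdot (tens x h) (tens x' h') = hdot x x' * hdot h h') /\
  closure (lspan [set tens u.1 u.2 | u in [set: F * H]]) = setT.

(* The operator tensor product of A with the identity of H. *)
Definition ampliation F H K (tens : {bilinear F -> H -> K}) (A : F -> F) :
    K -> K :=
  get [set B : K -> K |
    bounded_op B /\ forall x h, B (tens x h) = tens (A x) h].

End HilbertSpaces.

(* The free monoid on n generators is seq 'I_n: the unit is [::] and the
   product is concatenation. *)

Section Tuples.
Variables (R : realType) (n : nat).

Definition opword (H : Type) (T : 'I_n -> H -> H) (w : seq 'I_n) : H -> H :=
  foldr (fun i A => T i \o A) id w.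

Section Normed.
Variable H : normedModType R[i].
Implicit Type T : 'I_n -> H -> H.

(* Elements of the free algebra are finitely supported functions on the free
   monoid, with support msupp p and coefficients mcoeff w p. *)
Definition ncpoly := malg (fmonom 'I_n) R[i].

Definition opeval T (p : ncpoly) : H -> H :=
  \sum_(w <- msupp p) mcoeff w p *: opword T w.

Definition vanishes_at_length T (m : nat) : Prop :=
  forall w : seq 'I_n, size w = m -> opword T w = 0.

Definition nilpotent_tuple T : Prop := exists m, vanishes_at_length T m.

Definition nilpotent_of_index T (m : nat) : Prop :=
  vanishes_at_length T m /\
  forall k, vanishes_at_length T k -> (m <= k)%N.

Definition generated_algebra T : set (H -> H) :=
  smallest (@closed_subalgebra R H) (range T `|` [set id]).

End Normed.

(* Phi is the extension by continuity, to the norm-closed algebra generated by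
   W and the identity, of p(W) |-> p(T). *)
Definition functional_calculus (F H : normedModType R[i])
    (W : 'I_n -> F -> F) (T : 'I_n -> H -> H)
    (Phi : (F -> F) -> (H -> H)) : Prop :=
  [/\ (forall p, Phi (opeval W p) = opeval T p),
      (forall A, generated_algebra W A -> bounded_op (Phi A)) &
      (forall A, generated_algebra W A -> forall eps : R, 0 < eps ->
         exists2 delta : R, 0 < delta &
           forall B, generated_algebra W B ->
             opnorm (B - A) < delta -> opnorm (Phi B - Phi A) < eps)].

Section JointNorms.
Variable H : hilbertType R.
Implicit Type T : 'I_n -> H -> H.

(* The operator \sum_(|w| = k) T_w T_w^*. *)
Definition rowsum T (k : nat) : H -> H :=
  \sum_(w : k.-tuple 'I_n) (opword T w \o adjoint (opword T w)).

Definition joint_spectral_radius T : R :=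
  lim ((fun k : nat => opnorm (rowsum T k) `^ ((2 * k)%:R)^-1) @ \oo).

End JointNorms.

(* The value mu [::] is irrelevant: weights are indexed by nonempty words. *)

Definition weights (mu : seq 'I_n -> R) : Prop :=
  (forall w, w != [::] -> 0 <= mu w) /\
  (forall i, exists c, forall w, mu (i :: w) <= c).

Definition injective_weights (mu : seq 'I_n -> R) : Prop :=
  weights mu /\ forall w, w != [::] -> 0 < mu w.

Definition truncated_weights (mu : seq 'I_n -> R) : Prop :=
  exists (nu : seq 'I_n -> R) (Lambda : set (seq 'I_n)),
    [/\ injective_weights nu,
        ~ Lambda [::] &
        let Omega := [set w | exists a g, Lambda g /\ w = a ++ g] in
        forall w, w != [::] ->
          (Omega w -> mu w = 0) /\ (~ Omega w -> mu w = nu w)].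

(* W is the weighted left multi-shift with weights mu, on a Hilbert space with
   orthonormal basis e indexed by the free monoid. *)
Definition weighted_multishift (F : hilbertType R) (e : seq 'I_n -> F)
    (mu : seq 'I_n -> R) (W : 'I_n -> F -> F) : Prop :=
  weights mu /\
  forall i, bounded_op (W i) /\
    forall w, W i (e w) = (mu (i :: w))%:C *: e (i :: w).

End Tuples.

(* Main.v *)
(* Let [t k] be the square root of the norm of [\sum_(|w| = k) T_w T_w^*].  The
   weights [mu w = (k + 1) t k / (k t (k - 1))], [k = |w|], telescope: [W_w e_u] is
   a multiple of [e_(w u)] whose coefficient is at most [(k + 1) t k], with equality
   at the vacuum vector, which gives (i) and (ii); when [T] is nilpotent the
   convention [x / 0 = 0] performs the truncation.  Put [c k = 1 / ((k + 1) t k)].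
   Since [\sum c_k^2 t_k^2 <= \sum 1 / (k + 1)^2 <= pi^2 / 6], there is a bounded
   operator [Y : F (x) H -> H] of norm at most [pi / sqrt 6] sending [e_w (x) h] to
   [c_|w| T_w h].  It satisfies [Y (W_i (x) 1) = T_i Y] and [Y (e_0 (x) h) = h], so
   it induces a similarity between [T] and the compressions of [W_i (x) 1] to
   [(ker Y)^perp], and [Phi A h = Y (A e_0 (x) h)] is the functional calculus.

   For the spectral inequality, the operators [A] such that
   [Y (A (x) 1) = Phi A Y] form a closed algebra on which [Phi] is multiplicative.
   It contains the resolvents of [p(W)] at large scalars, hence, moving along rays,
   at all scalars of modulus larger than the spectral radius of [p(W)]; their images
   are resolvents of [p(T)]. *)

Require Import Defs.
From HB Require Import structures.
From mathcomp Require Import all_boot all_order all_algebra.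
From mathcomp Require Import finmap complex.
From mathcomp Require Import all_classical all_reals all_analysis.
From mathcomp Require Import -(notations) monalg.
From mathcomp Require Import ring lra zify.

Set Implicit Arguments.
Unset Strict Implicit.
Unset Printing Implicit Defensive.

Import Order.TTheory GRing.Theory Num.Theory.
Import numFieldNormedType.Exports.

Local Open Scope complex_scope.
Local Open Scope classical_set_scope.
Local Open Scope ring_scope.

(** * Norms, Hilbert spaces and adjoints *)

(** The factor [k + 1] is the price of a bounded [Y]: it makes [c_k^2 t_k^2] summable, and since it
    grows only polynomially it disappears under [2k]-th roots, so the joint spectral radius is
    unchanged. The bound on the products of weights rests on [t (j + k) <= t j * t k] together with
    [k + j + 1 <= (k + 1) (j + 1)]. Operators [A (x) 1] for a general bounded [A] are never built.
    Statements about [Phi] are phrased through the vectors [A e_0 (x) h] and through identities on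
    elementary tensors; complete boundedness then comes from expanding finitely many vectors of [H]
    in an orthonormal system. The obstacle in the spectral inequality is that a norm-closed algebra
    need not contain the inverses of its elements: a resolvent of [p(W)] exists among all bounded
    operators, while [Phi] is multiplicative only on a subalgebra. Outside the disc given by the
    spectral radius every point is joined to infinity by a ray of resolvent points, and Neumann
    series carry membership in the subalgebra along that ray. *)

Section RealNorm.
Variables (R : realType) (V : normedModType R[i]).
Implicit Types (x y : V) (a : R[i]).

Lemma normE x : `|x| = (rnorm x)%:C.
Proof. by rewrite /rnorm RRe_real ?normr_real. Qed.

Lemma rnorm_ge0 x : 0 <= rnorm x.
Proof. by rewrite -lecR -normE normr_ge0. Qed.

Lemma rnorm0 : rnorm (0 : V) = 0.
Proof. by rewrite /rnorm normr0. Qed.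

Lemma rnorm_eq0 x : rnorm x = 0 -> x = 0.
Proof. by move=> x0; apply: normr0_eq0; rewrite normE x0. Qed.

Lemma rnormN x : rnorm (- x) = rnorm x.
Proof. by rewrite /rnorm normrN. Qed.

Lemma rnorm_distC x y : rnorm (x - y) = rnorm (y - x).
Proof. by rewrite -rnormN opprB. Qed.

Lemma rnormD x y : rnorm (x + y) <= rnorm x + rnorm y.
Proof. by rewrite -lecR rmorphD /= -!normE ler_normD. Qed.

Lemma rnormB x y : rnorm (x - y) <= rnorm x + rnorm y.
Proof. by rewrite -(rnormN y) rnormD. Qed.

Lemma rnorm_distD z x y : rnorm (x - y) <= rnorm (x - z) + rnorm (z - y).
Proof. by rewrite (le_trans _ (rnormD _ _)) // addrA subrK. Qed.

Lemma rnormZ a x : rnorm (a *: x) = rnorm a * rnorm x.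
Proof.
by apply: complexI; rewrite rmorphM /= /rnorm !RRe_real ?normr_real // normrZ.
Qed.

Lemma rnorm_sum I (r : seq I) (P : pred I) (f : I -> V) :
  rnorm (\sum_(i <- r | P i) f i) <= \sum_(i <- r | P i) rnorm (f i).
Proof.
elim/big_ind2: _ => [|x a y b xa yb|//]; first by rewrite rnorm0.
by rewrite (le_trans (rnormD _ _)) // lerD.
Qed.

End RealNorm.

Section ComplexNorm.
Variable R : realType.
Implicit Types a b : R[i].

Lemma cnormE a : `|a| = (rnorm a)%:C.
Proof. by rewrite /rnorm RRe_real ?normr_real. Qed.

Lemma cnormM a b : rnorm (a * b) = rnorm a * rnorm b.
Proof. by apply: complexI; rewrite rmorphM /= -!cnormE normrM. Qed.

Lemma cnormV a : rnorm a^-1 = (rnorm a)^-1.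
Proof. by apply: complexI; rewrite fmorphV /= -!cnormE normfV. Qed.

Lemma cnorm_ge0 a : 0 <= rnorm a.
Proof. by rewrite -lecR -cnormE normr_ge0. Qed.

Lemma cnorm_eq0 a : rnorm a = 0 -> a = 0.
Proof. by move=> x0; apply: normr0_eq0; rewrite cnormE x0. Qed.

Lemma cnormN a : rnorm (- a) = rnorm a.
Proof. by rewrite /rnorm normrN. Qed.

Lemma cnormD a b : rnorm (a + b) <= rnorm a + rnorm b.
Proof. by rewrite -lecR rmorphD /= -!cnormE ler_normD. Qed.

Lemma cnorm0 : rnorm (0 : R[i]) = 0.
Proof. by rewrite /rnorm normr0. Qed.

Lemma cnorm_real (r : R) : rnorm r%:C = `|r|.
Proof. by rewrite /rnorm normc_def /= expr0n addr0 sqrtr_sqr. Qed.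

Lemma cnorm_conj a : rnorm (Num.conj a) = rnorm a.
Proof. by rewrite /rnorm norm_conjC. Qed.

Lemma Re_le_cnorm a : complex.Re a <= rnorm a.
Proof.
by rewrite (le_trans (ler_norm _)) // -lecR -cnormE normc_ge_Re.
Qed.

Lemma cnorm_ge0E a : 0 <= a -> a = (rnorm a)%:C.
Proof. by move=> a0; rewrite -cnormE ger0_norm. Qed.

Lemma sqr_cnorm a : a * Num.conj a = ((rnorm a)%:C ^+ 2 : R[i]).
Proof. by rewrite -normCK cnormE. Qed.

Lemma gt0_complexP a : 0 < a -> exists2 r : R, 0 < r & a = r%:C.
Proof.
move=> a0; exists (rnorm a); last by rewrite -cnorm_ge0E // ltW.
by rewrite -ltcR -cnorm_ge0E // ltW.
Qed.

Lemma Re_conj a : complex.Re (Num.conj a) = complex.Re a.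
Proof. by case: a. Qed.

End ComplexNorm.

Section MetricTopology.
Variable R : realType.

Lemma closureP (V : normedModType R[i]) (A : set V) x :
  closure A x <-> forall eps : R, 0 < eps -> exists2 y, A y & rnorm (x - y) < eps.
Proof.
split=> [cAx eps eps0|Ax B /nbhs_normP [_ /gt0_complexP [r r0 ->] sB]].
  have [|y [Ay /= xy]] := cAx [set y | rnorm (x - y) < eps]; last by exists y.
  apply/nbhs_normP; exists eps%:C => /=; first by rewrite ltcR.
  by move=> y /=; rewrite normE ltcR.
have [y Ay xy] := Ax _ r0; exists y; split=> //.
by apply: sB; rewrite /= normE ltcR.
Qed.

Lemma closedP (V : normedModType R[i]) (A : set V) :
  closed A <-> forall x, (forall eps : R, 0 < eps ->
    exists2 y, A y & rnorm (x - y) < eps) -> A x.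
Proof.
split=> [cA x xA|hA x /closureP]; last exact: hA.
by apply: cA; apply/closureP.
Qed.

Lemma complete_rnorm (V : completeNormedModType R[i]) (u : nat -> V) :
  (forall eps : R, 0 < eps -> exists N, forall m n, (N <= m)%N -> (N <= n)%N ->
     rnorm (u m - u n) < eps) ->
  exists l, forall eps : R, 0 < eps -> exists N, forall n, (N <= n)%N ->
     rnorm (l - u n) < eps.
Proof.
move=> uC; have : cauchy (u @ \oo).
  apply/cauchyP => _ /gt0_complexP [r r0 ->]; have [N uN] := uC _ r0.
  exists (u N); exists N => // n /= Nn.
  by rewrite -ball_normE /= normE ltcR uN.
move=> /cauchy_cvgP /cvg_ex [l ul]; exists l => eps eps0.
move/cvgrPdist_lt : ul => /(_ eps%:C); rewrite ltcR => /(_ eps0) [N _ uN].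
by exists N => n Nn; have := uN n Nn; rewrite /= normE ltcR.
Qed.

Lemma bounded_opP (U V : normedModType R[i]) (f : U -> V) : linear f ->
  continuous f <-> exists2 C : R, 0 <= C & forall x, rnorm (f x) <= C * rnorm x.
Proof.
move=> lf; pose fL := GRing.isLinear.Build _ _ _ _ f lf.
pose F : {linear U -> V} := HB.pack f fL.
rewrite -[f]/(F : U -> V) -linear_bounded_continuous linear_boundedP.
split=> [/pinfty_ex_gt0 [_ /gt0_complexP [r r0 ->] fr]|[C C0 fC]].
  exists r => [|x]; first exact: ltW.
  by rewrite -lecR rmorphM /= -!normE.
exists C%:C; split=> [|a Ca x]; first by apply/complex_realP; exists C.
rewrite (le_trans _ (ler_wpM2r _ (ltW Ca))) //.
by rewrite !normE -rmorphM /= lecR.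
Qed.

End MetricTopology.

Section InnerProduct.
Variables (R : realType) (H : hilbertType R).
Implicit Types (x y z : H) (a : R[i]).

Lemma hdotC x y : hdot x y = Num.conj (hdot y x).
Proof. by rewrite hermC expr0 mul1r. Qed.

Lemma hdotDl x y z : hdot (x + y) z = hdot x z + hdot y z.
Proof. exact: linearDl. Qed.

Lemma hdotBl x y z : hdot (x - y) z = hdot x z - hdot y z.
Proof. exact: linearBl. Qed.

Lemma hdotZl a x z : hdot (a *: x) z = a * hdot x z.
Proof. exact: linearZl_LR. Qed.

Lemma hdotDr x y z : hdot z (x + y) = hdot z x + hdot z y.
Proof. exact: linearDr. Qed.

Lemma hdotBr x y z : hdot z (x - y) = hdot z x - hdot z y.
Proof. exact: linearBr. Qed.

Lemma hdotZr a x z : hdot z (a *: x) = Num.conj a * hdot z x.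
Proof. exact: linearZr_LR. Qed.

Lemma hdot0l x : hdot 0 x = 0.
Proof. exact: linear0l. Qed.

Lemma hdot0r x : hdot x 0 = 0.
Proof. exact: linear0r. Qed.

Lemma hdot_suml I (r : seq I) (f : I -> H) z :
  hdot (\sum_(i <- r) f i) z = \sum_(i <- r) hdot (f i) z.
Proof. exact: linear_sumlz. Qed.

Lemma hdot_sumr I (r : seq I) (f : I -> H) z :
  hdot z (\sum_(i <- r) f i) = \sum_(i <- r) hdot z (f i).
Proof. exact: linear_sumr. Qed.

Lemma hdotxx x : hdot x x = (rnorm x ^+ 2)%:C :> R[i].
Proof. by rewrite hdotE normE rmorphXn. Qed.

Lemma rnorm_sqD x y :
  rnorm (x + y) ^+ 2 = rnorm x ^+ 2 + rnorm y ^+ 2 + 2 * complex.Re (hdot x y).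
Proof.
have rnormE z : rnorm z ^+ 2 = complex.Re (hdot z z) by rewrite hdotxx.
have ReD (a b : R[i]) : complex.Re (a + b) = complex.Re a + complex.Re b.
  by case: a b => ? ? [].
rewrite !rnormE hdotDl !hdotDr (hdotC y x) !ReD Re_conj; ring.
Qed.

Lemma rnorm_pythagoras x y : hdot x y = 0 ->
  rnorm (x + y) ^+ 2 = rnorm x ^+ 2 + rnorm y ^+ 2.
Proof. by move=> xy; rewrite rnorm_sqD xy /= mulr0 addr0. Qed.

Lemma parallelogram x y :
  rnorm (x + y) ^+ 2 + rnorm (x - y) ^+ 2 =
  2 * rnorm x ^+ 2 + 2 * rnorm y ^+ 2.
Proof.
rewrite !rnorm_sqD rnormN; have -> : hdot x (- y) = - hdot x y by exact: linearNr.
by rewrite raddfN /=; ring.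
Qed.

(** Removing from [x] its component along [y] shortens it by an explicit amount. This gives
    Cauchy-Schwarz, since the left side is nonnegative, and the near-orthogonality of minimising
    sequences. *)
Lemma rnorm_sq_residual x y : y != 0 ->
  rnorm (x - (hdot x y / (rnorm y ^+ 2)%:C) *: y) ^+ 2 =
  rnorm x ^+ 2 - rnorm (hdot x y) ^+ 2 / rnorm y ^+ 2.
Proof.
move=> y0; apply: complexI; rewrite -[LHS]hdotxx.
have [q [qE qr q0]] : exists q, [/\ hdot y y = q, Num.conj q = q & q != 0].
  by exists (hdot y y); split; rewrite -?hdotC // hdotE expf_neq0 // normr_eq0.
have -> : (rnorm y ^+ 2)%:C = q by rewrite -hdotxx.
have -> : (rnorm x ^+ 2 - rnorm (hdot x y) ^+ 2 / rnorm y ^+ 2)%:C =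
    hdot x x - hdot x y * Num.conj (hdot x y) / q.
  by rewrite -qE sqr_cnorm !hdotxx -rmorphXn -fmorphV -rmorphM -rmorphB.
rewrite hdotBl !hdotBr !hdotZl !hdotZr rmorphM fmorphV /= qr qE (hdotC y x).
by field.
Qed.

Lemma cauchy_schwarz x y : rnorm (hdot x y) <= rnorm x * rnorm y.
Proof.
have [->|y0] := eqVneq y 0; first by rewrite hdot0r cnorm0 rnorm0 mulr0.
have n0 : 0 < rnorm y.
  by rewrite lt_neqAle rnorm_ge0 andbT eq_sym; apply: contra_neq y0 => /rnorm_eq0.
rewrite -(@ler_pXn2r _ 2) ?nnegrE ?cnorm_ge0 ?mulr_ge0 ?rnorm_ge0 //.
rewrite exprMn -ler_pdivrMr ?exprn_gt0 // -subr_ge0 -rnorm_sq_residual //.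
exact: sqr_ge0.
Qed.

Lemma hdot_inj x y : (forall z, hdot x z = hdot y z) -> x = y.
Proof.
move=> xy; apply/eqP; rewrite -subr_eq0; apply/eqP/normr0_eq0/eqP.
by rewrite -sqrf_eq0 -hdotE hdotBl xy subrr.
Qed.

Lemma hdot_injr x y : (forall z, hdot z x = hdot z y) -> x = y.
Proof. by move=> xy; apply: hdot_inj => z; rewrite hdotC xy -hdotC. Qed.

Lemma rnorm_le_hdot x (C : R) : 0 <= C ->
  (forall y, rnorm (hdot x y) <= C * rnorm y) -> rnorm x <= C.
Proof.
move=> C0 /(_ x); rewrite hdotxx cnorm_real ger0_norm ?sqr_ge0 // expr2.
have [->|x0] := eqVneq (rnorm x) 0; first by [].
by rewrite ler_pM2r // lt_neqAle eq_sym x0 rnorm_ge0.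
Qed.

End InnerProduct.

Lemma small_eq0 (R : realType) (a : R) : 0 <= a ->
  (forall eps : R, 0 < eps -> a <= eps) -> a = 0.
Proof.
move=> a0 ha; apply/eqP; rewrite eq_le a0 andbT.
by apply/ler_addgt0Pl => e e0; rewrite addr0 ha.
Qed.

(** * Orthogonal projection and the Riesz representation *)

Section ProjectionTheorem.
Variables (R : realType) (H : hilbertType R).
Implicit Types (x y z : H) (a : R[i]).

Lemma projection_theorem (S : set H) x : S 0 ->
  (forall (a : R[i]) x y, S x -> S y -> S (a *: x + y)) -> closed S ->
  exists2 y, S y & forall z, S z -> hdot (x - y) z = 0.
Proof.
move=> S0 SL Sc.
pose E : set R := [set rnorm (x - y) ^+ 2 | y in S].
have hE : has_inf E.
  split; first by exists (rnorm (x - 0) ^+ 2); exists 0.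
  by exists 0 => _ [y _ <-]; exact: sqr_ge0.
pose D := inf E.
have DE y : S y -> D <= rnorm (x - y) ^+ 2.
  by move=> Sy; apply: ge_inf; [exact: hE.2|exists y].
pose r (k : nat) : R := k.+1%:R^-1.
have r0 k : 0 < r k by rewrite invr_gt0 ltr0Sn.
have /choice [u uP] : forall k, exists y, S y /\ rnorm (x - y) ^+ 2 < D + r k.
  move=> k; have [_ [y Sy <-] yD] := inf_adherent (r0 k) hE.
  by exists y.
(* Moving [u k] inside [S] along [z] would lower the squared distance by [|<x - u k, z>|^2 / |z|^2],
   but it is already within [r k] of the infimum [D]. Orthogonality then passes to the limit without
   showing that the limit is a minimiser. *)
have near_orth k z : S z -> rnorm (hdot (x - u k) z) ^+ 2 <= r k * rnorm z ^+ 2.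
  move=> Sz; have [->|z0] := eqVneq z 0.
    by rewrite hdot0r cnorm0 rnorm0 expr0n mulr0.
  have n0 : 0 < rnorm z ^+ 2.
    rewrite exprn_gt0 // lt_neqAle rnorm_ge0 andbT eq_sym.
    by apply: contra_neq z0 => /rnorm_eq0.
  rewrite -ler_pdivrMr //.
  have [Su uD] := uP k.
  have := DE _ (SL (hdot (x - u k) z / (rnorm z ^+ 2)%:C) z (u k) Sz Su).
  rewrite opprD [- _ - _]addrC addrA rnorm_sq_residual // => hD.
  lra.
(* The midpoint of [u m] and [u n] lies in [S], so its squared distance to [x] is at least [D]; the
   parallelogram law does the rest. *)
have dist m n : rnorm (u m - u n) ^+ 2 <= 2 * (r m + r n).
  have [Sm um] := uP m; have [Sn un] := uP n.
  have Smid : S (2^-1 *: (u m + u n)).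
    rewrite -[_ *: _]addr0; apply: (SL) => //.
    by rewrite -[u m]scale1r; exact: (SL).
  have := parallelogram (x - u n) (x - u m).
  rewrite [_ - _ - (_ - _)](_ : _ = u m - u n); last first.
    by rewrite opprB addrC addrA subrK.
  rewrite [_ + (x - u m)](_ : _ = 2 *: (x - 2^-1 *: (u m + u n))); last first.
    rewrite scalerBr scalerA mulfV ?pnatr_eq0 // scale1r scaler_nat mulr2n opprD.
    by rewrite addrACA; congr (_ + _); rewrite addrC.
  rewrite rnormZ exprMn.
  have -> : rnorm (2 : R[i]) = 2 :> R.
    by have := cnorm_real (2 : R); rewrite rmorph_nat => ->; rewrite normr_nat.
  by have := DE _ Smid; lra.
have rlim (eps : R) : 0 < eps -> exists N, forall k, (N <= k)%N -> r k < eps.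
  move=> e0; exists (Num.truncn eps^-1) => k Nk.
  rewrite /r invf_plt ?posrE ?ltr0Sn //.
  by rewrite (lt_le_trans (truncnS_gt _)) // ler_nat ltnS.
have [|l ul] := @complete_rnorm R H u.
  move=> eps e0; have [|N rN] := rlim (eps ^+ 2 / 4); first by rewrite divr_gt0 ?exprn_gt0.
  exists N => m n Nm Nn; rewrite -(@ltr_pXn2r _ 2) ?nnegrE ?rnorm_ge0 ?ltW //.
  by have := dist m n; have := rN _ Nm; have := rN _ Nn; lra.
exists l.
  move/closedP : Sc; apply=> eps e0; have [N uN] := ul _ e0.
  by exists (u N); [case: (uP N)|apply: uN].
move=> z Sz; apply: cnorm_eq0; apply: small_eq0 (cnorm_ge0 _) _ => eps e0.
have n0 : 0 < rnorm z + 1 by rewrite ltr_wpDl ?rnorm_ge0.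
(* The same [d] bounds both errors: [|l - u k| < d] and [r k < d^2]. *)
have [d d0 dz] : exists2 d, 0 < d & d * rnorm z <= eps / 2.
  exists (eps / 2 / (rnorm z + 1)); first by rewrite !divr_gt0.
  by rewrite mulrAC ler_pdivrMr // ler_wpM2l ?divr_ge0 ?(ltW e0) // lerDl.
have [N1 h1] := ul _ d0; have [|N2 h2] := rlim (d ^+ 2); first by rewrite exprn_gt0.
pose k := maxn N1 N2.
have -> : x - l = (x - u k) - (l - u k) by rewrite opprB addrA subrK.
rewrite hdotBl (le_trans (cnormD _ _)) // cnormN [leRHS](splitr eps) lerD //.
  apply: le_trans dz.
  rewrite -ler_sqr ?nnegrE ?cnorm_ge0 ?mulr_ge0 ?rnorm_ge0 ?(ltW d0) //.
  rewrite (le_trans (near_orth k z Sz)) // exprMn ler_wpM2r ?sqr_ge0 //.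
  by rewrite ltW // h2 // leq_maxr.
rewrite (le_trans (cauchy_schwarz _ _)) // (le_trans _ dz) // ler_wpM2r ?rnorm_ge0 //.
by rewrite ltW // h1 // leq_maxl.
Qed.

Lemma riesz (f : H -> R[i]) (C : R) :
  (forall a x y, f (a *: x + y) = a * f x + f y) ->
  (forall x, rnorm (f x) <= C * rnorm x) ->
  exists y, forall x, f x = hdot x y.
Proof.
move=> fL fC.
have f0 : f 0 = 0.
  by apply: cnorm_eq0; apply/eqP; rewrite eq_le cnorm_ge0 (le_trans (fC 0)) // rnorm0 mulr0.
have fB x y : f (x - y) = f x - f y.
  by rewrite addrC -scaleN1r fL mulN1r addrC.
have [/existsNP [x fx]|nf] := pselect (~ forall x, f x = 0); last first.
  by exists 0 => x; rewrite hdot0r; apply: contrapT => h; apply: nf => /(_ x).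
(* The representing vector is a multiple of [x - p], where [p] is the projection on the kernel of
   [f] of a point [x] outside it. *)
have [|a u v||p fp hp] := @projection_theorem (fun x => f x = 0) x.
- exact: f0.
- by move=> fu fv; rewrite fL fu fv mulr0 addr0.
- apply/closedP => u hu; apply: cnorm_eq0; apply: small_eq0 (cnorm_ge0 _) _ => e e0.
  have C1 : 0 < `|C| + 1 by rewrite ltr_wpDl.
  have [|v fv uv] := hu (e / (`|C| + 1)); first by rewrite divr_gt0.
  rewrite -[f u]subr0 -fv -fB (le_trans (fC _)) //.
  move: uv; rewrite ltr_pdivlMr // => uv; rewrite (le_trans _ (ltW uv)) //.
  by rewrite mulrC ler_wpM2l ?rnorm_ge0 // (le_trans (ler_norm _)) // lerDl.
pose q := x - p; have fq : f q = f x by rewrite fB fp subr0.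
have q0 : hdot q q != 0.
  rewrite hdotE expf_neq0 // normr_eq0; apply/eqP => q0.
  by apply: fx; rewrite -fq q0.
exists ((Num.conj (f q) / hdot q q) *: q) => y.
(* The second argument is killed by [f], and [q] is orthogonal to the kernel. *)
have : hdot q (f q *: y - f y *: q) = 0.
  apply: hp; rewrite fB -[f q *: y]addr0 -[f y *: q]addr0 !fL f0 !addr0.
  by rewrite mulrC subrr.
rewrite hdotBr !hdotZr => /subr0_eq h.
rewrite rmorphM /= fmorphV /= conjCK (hdotC y q).
rewrite -[Num.conj (hdot q q)]hdotC.
have := congr1 Num.conj h; rewrite !rmorphM /= !conjCK -(hdotC q q) => h'.
by rewrite mulrAC h' mulfK.
Qed.

End ProjectionTheorem.

Section Adjoints.
Variable R : realType.
Implicit Types H K : hilbertType R.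

Lemma bounded_op_linear (U V : normedModType R[i]) (f : U -> V) : bounded_op f ->
  [/\ f 0 = 0, (forall x y, f (x + y) = f x + f y),
      (forall x y, f (x - y) = f x - f y) &
      forall (a : R[i]) x, f (a *: x) = a *: f x].
Proof.
move=> [fl _].
have f0 : f 0 = 0.
  by have := fl (-1) 0 0; rewrite scaler0 addr0 scaleN1r addNr.
have fZ a x : f (a *: x) = a *: f x by have := fl a x 0; rewrite f0 !addr0.
have fD x y : f (x + y) = f x + f y by have := fl 1 x y; rewrite !scale1r.
by split=> // x y; rewrite fD -scaleN1r fZ scaleN1r.
Qed.

Lemma bounded_op_bound (U V : normedModType R[i]) (f : U -> V) : bounded_op f ->
  exists2 C : R, 0 <= C & forall x, rnorm (f x) <= C * rnorm x.
Proof. by move=> [fl fc]; apply/(bounded_opP fl). Qed.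

Lemma bounded_op_intro (U V : normedModType R[i]) (f : U -> V) (C : R) :
  linear f -> (forall x, rnorm (f x) <= C * rnorm x) -> bounded_op f.
Proof.
move=> fl fC; split=> //; apply/(bounded_opP fl); exists `|C| => // x.
by rewrite (le_trans (fC x)) // ler_wpM2r ?rnorm_ge0 // ler_norm.
Qed.

Lemma adjointP H K (A : H -> K) : bounded_op A ->
  bounded_op (adjoint A) /\ forall x y, hdot (A x) y = hdot x (adjoint A y).
Proof.
move=> bA; have [A0 AD AB AZ] := bounded_op_linear bA.
have [C C0 AC] := bounded_op_bound bA.
have AyC y x : rnorm (hdot (A x) y) <= C * rnorm y * rnorm x.
  by rewrite (le_trans (cauchy_schwarz _ _)) // mulrAC ler_wpM2r ?rnorm_ge0.
have adjE : forall x y, hdot (A x) y = hdot x (adjoint A y).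
  have /choice [B BP] : forall y, exists z, forall x, hdot (A x) y = hdot x z.
    move=> y; apply: (riesz (C := C * rnorm y)) => [a u v|//].
    by rewrite bA.1 hdotDl hdotZl.
  by apply: (@getPex _ [set B : K -> H | forall x y, hdot (A x) y = hdot x (B y)]); exists B.
split=> //; apply: (bounded_op_intro (C := C)) => [a x y|x].
  by apply: hdot_injr => z; rewrite -adjE !hdotDr !hdotZr !adjE.
apply: rnorm_le_hdot => [|y]; first by rewrite mulr_ge0 ?rnorm_ge0.
by rewrite hdotC cnorm_conj -adjE.
Qed.

Lemma adjoint_unique H K (A : H -> K) (B : K -> H) : bounded_op A ->
  (forall x y, hdot (A x) y = hdot x (B y)) -> adjoint A = B.
Proof.
move=> /adjointP [_ hA] hB; apply/funext => y; apply: hdot_injr => x.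
by rewrite -hA hB.
Qed.

End Adjoints.

(** * Bounded operators and their extension by continuity *)

Section OperatorNorm.
Variables (R : realType) (U V : normedModType R[i]).
Implicit Types f g : U -> V.

Lemma opnorm_le f (C : R) : 0 <= C ->
  (forall x, rnorm (f x) <= C * rnorm x) -> opnorm f <= C.
Proof.
move=> C0 fC; apply: ge_sup; first by exists (rnorm (f 0)); exists 0; rewrite //= rnorm0.
by move=> _ [x /= x1 <-]; rewrite (le_trans (fC x)) // ler_piMr.
Qed.

Lemma opnorm_ge f (C : R) x : (forall x, rnorm (f x) <= C * rnorm x) ->
  rnorm x <= 1 -> rnorm (f x) <= opnorm f.
Proof.
move=> fC x1; apply: sup_upper_bound; last by exists x.
split; first by exists (rnorm (f x)); exists x.
exists `|C| => _ [y /= y1 <-]; rewrite (le_trans (fC y)) //.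
by rewrite (le_trans (ler_wpM2r _ (ler_norm C))) ?rnorm_ge0 // ler_piMr.
Qed.

Lemma opnorm_ge0 f : bounded_op f -> 0 <= opnorm f.
Proof.
move=> /bounded_op_bound [C C0 fC].
by rewrite (le_trans (rnorm_ge0 (f 0))) // (opnorm_ge fC) // rnorm0.
Qed.

Lemma rnorm_real_scale (r : R) (x : U) : 0 <= r -> rnorm (r%:C *: x) = r * rnorm x.
Proof. by move=> r0; rewrite rnormZ cnorm_real ger0_norm. Qed.

Lemma opnormP f x : bounded_op f -> rnorm (f x) <= opnorm f * rnorm x.
Proof.
move=> bf; have [C C0 fC] := bounded_op_bound bf.
have [f0 _ _ fZ] := bounded_op_linear bf.
have [->|x0] := eqVneq x 0; first by rewrite f0 !rnorm0 mulr0.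
have n0 : 0 < rnorm x.
  by rewrite lt_neqAle rnorm_ge0 andbT eq_sym; apply: contra_neq x0 => /rnorm_eq0.
have i0 : 0 <= (rnorm x)^-1 by rewrite invr_ge0 ltW.
have := @opnorm_ge f C ((rnorm x)^-1%:C *: x) fC.
rewrite rnorm_real_scale // mulVf ?gt_eqF // lexx => /(_ isT).
by rewrite fZ rnormZ cnorm_real ger0_norm // ler_pdivrMl // mulrC.
Qed.

End OperatorNorm.

Section BoundedOperations.
Variable R : realType.
Implicit Types U V W : normedModType R[i].

Lemma bounded_op_id U : bounded_op (@id U).
Proof. by apply: (bounded_op_intro (C := 1)) => // x; rewrite mul1r. Qed.

Lemma bounded_op_comp U V W (f : V -> W) (g : U -> V) :
  bounded_op f -> bounded_op g -> bounded_op (f \o g).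
Proof.
move=> bf bg; have [C C0 fC] := bounded_op_bound bf.
have [D D0 gD] := bounded_op_bound bg.
apply: (bounded_op_intro (C := C * D)) => [a x y|x] /=; first by rewrite bg.1 bf.1.
by rewrite (le_trans (fC _)) // -mulrA ler_wpM2l.
Qed.

Lemma bounded_op_lin U V (a : R[i]) (f g : U -> V) :
  bounded_op f -> bounded_op g -> bounded_op (a *: f + g).
Proof.
move=> bf bg; have [C C0 fC] := bounded_op_bound bf.
have [D D0 gD] := bounded_op_bound bg.
apply: (bounded_op_intro (C := rnorm a * C + D)) => [b x y|x].
  have -> z : (a *: f + g) z = a *: f z + g z by [].
  rewrite -[(a *: f + g) y]/(a *: f y + g y) -[(a *: f + g) x]/(a *: f x + g x).
  rewrite bf.1 bg.1 !scalerDr !scalerA [a * b]mulrC -!addrA; congr (_ + _).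
  by rewrite addrCA.
rewrite -[(a *: f + g) x]/(a *: f x + g x) (le_trans (rnormD _ _)) //.
by rewrite mulrDl rnormZ -mulrA lerD // ler_wpM2l ?cnorm_ge0.
Qed.

Lemma bounded_op0 U V : bounded_op (0 : U -> V).
Proof.
apply: (bounded_op_intro (C := 0)) => [a x y|x].
  by rewrite -[0 (a *: x + y)]/(0 : V) -[0 x]/(0 : V) -[0 y]/(0 : V) scaler0 addr0.
by rewrite -[0 x]/(0 : V) rnorm0 mul0r.
Qed.

Lemma bounded_opZ U V (a : R[i]) (f : U -> V) : bounded_op f -> bounded_op (a *: f).
Proof. by move=> bf; rewrite -[_ *: _]addr0; apply: bounded_op_lin bf (bounded_op0 _ _). Qed.

Lemma bounded_opD U V (f g : U -> V) :
  bounded_op f -> bounded_op g -> bounded_op (f + g).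
Proof. by move=> bf bg; rewrite -[f]scale1r; apply: bounded_op_lin. Qed.

Lemma bounded_opB U V (f g : U -> V) :
  bounded_op f -> bounded_op g -> bounded_op (f - g).
Proof. by move=> bf bg; rewrite addrC -scaleN1r; apply: bounded_op_lin. Qed.

Lemma bounded_op_sum U V I (r : seq I) (f : I -> U -> V) :
  (forall i, bounded_op (f i)) -> bounded_op (\sum_(i <- r) f i).
Proof.
move=> bf; elim/big_ind: _ => [|g h|i _]; [exact: bounded_op0|exact: bounded_opD|exact: bf].
Qed.

Lemma dense_bound U V (f : U -> V) (S : set U) (C : R) : bounded_op f ->
  closure S = setT -> 0 <= C -> (forall x, S x -> rnorm (f x) <= C * rnorm x) ->
  forall x, rnorm (f x) <= C * rnorm x.
Proof.
move=> bf cS C0 fC x; have [D D0 fD] := bounded_op_bound bf.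
have [_ _ fB _] := bounded_op_linear bf.
apply/ler_addgt0Pr => e e0.
(* For [y] in [S], [|f x| <= D |x - y| + C |y| <= C |x| + (C + D) |x - y|]. *)
have p0 : 0 < C + D + 1 by rewrite ltr_wpDl ?addr_ge0.
have /closureP /(_ (e / (C + D + 1))) : closure S x by rewrite cS.
rewrite divr_gt0 // => /(_ isT) [y Sy]; rewrite ltr_pdivlMr // => xy.
have -> : f x = f (x - y) + f y by rewrite fB subrK.
have h1 := rnormD (f (x - y)) (f y); have h2 := fD (x - y); have h3 := fC _ Sy.
have h4 : rnorm y <= rnorm x + rnorm (x - y).
  by rewrite -{1}[y](subKr x) rnormB.
have h5 := ler_wpM2l C0 h4; have := rnorm_ge0 (x - y).
nra.
Qed.

Lemma dense_eq U V (f g : U -> V) (S : set U) : bounded_op f -> bounded_op g ->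
  closure (lspan S) = setT -> (forall x, S x -> f x = g x) -> f = g.
Proof.
move=> bf bg cS fg; apply/funext => x.
have bfg := bounded_opB bf bg.
apply/eqP; rewrite -subr_eq0; apply/eqP/rnorm_eq0/eqP.
rewrite eq_le rnorm_ge0 andbT -[X in _ <= X](mul0r (rnorm x)).
apply: (dense_bound bfg cS) => // {}x [k [a [y [Sy ->]]]].
rewrite mul0r -[(f - g) _]/(f _ - g _).
have lin (h : U -> V) : bounded_op h -> h (\sum_i a i *: y i) = \sum_i a i *: h (y i).
  move=> /bounded_op_linear [h0 hD _ hZ].
  by rewrite (big_morph h hD h0); apply: eq_bigr => i _; rewrite hZ.
rewrite !lin // (eq_bigr (fun i => a i *: g (y i))) => [|i _]; last by rewrite fg.
by rewrite subrr rnorm0.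
Qed.

Lemma rnorm_lin U (a : R[i]) (u1 u2 v1 v2 : U) :
  rnorm ((a *: u1 + u2) - (a *: v1 + v2)) <= rnorm a * rnorm (u1 - v1) + rnorm (u2 - v2).
Proof. by rewrite opprD addrACA -scalerBr (le_trans (rnormD _ _)) // rnormZ. Qed.

Lemma closure_lin U (S : set U) :
  (forall (a : R[i]) x y, S x -> S y -> S (a *: x + y)) ->
  forall (a : R[i]) x y, closure S x -> closure S y -> closure S (a *: x + y).
Proof.
move=> SL a x y /closureP cx /closureP cy; apply/closureP => e e0.
have p0 : 0 < rnorm a + 1 by rewrite ltr_wpDl ?cnorm_ge0.
have [|x' Sx xx'] := cx (e / 2 / (rnorm a + 1)); first by rewrite !divr_gt0.
have [|y' Sy yy'] := cy (e / 2); first by rewrite divr_gt0.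
exists (a *: x' + y'); first exact: (SL).
rewrite opprD addrACA -scalerBr (le_lt_trans (rnormD _ _)) // [ltRHS]splitr ler_ltD //.
rewrite rnormZ; move: xx'; rewrite ltr_pdivlMr // => /ltW; apply: le_trans.
by rewrite mulrC ler_wpM2l ?rnorm_ge0 // lerDl.
Qed.

(** A densely defined operator is given by its graph [G]. No choice of representatives is then
    needed: the bound applied to differences makes the graph single-valued. *)
Lemma bounded_extension U (W : completeNormedModType R[i]) (G : set (U * W)) (C : R) :
  0 <= C ->
  (forall (a : R[i]) p q, G p -> G q -> G (a *: p.1 + q.1, a *: p.2 + q.2)) ->
  (forall p, G p -> rnorm p.2 <= C * rnorm p.1) ->
  closure [set p.1 | p in G] = setT ->
  exists B : U -> W, [/\ bounded_op B, forall x, rnorm (B x) <= C * rnorm x &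
    forall p, G p -> B p.1 = p.2].
Proof.
move=> C0 GL GC Gd.
have GB p q : G p -> G q -> rnorm (p.2 - q.2) <= C * rnorm (p.1 - q.1).
  move=> Gp Gq; have := GC _ (GL (-1) _ _ Gq Gp).
  by rewrite /= !scaleN1r !(addrC (- _)).
have dense x (e : R) : 0 < e -> exists2 p, G p & rnorm (x - p.1) < e.
  move=> e0; have /closureP /(_ _ e0) : closure [set p.1 | p in G] x by rewrite Gd.
  by move=> [_ [p Gp <-] xp]; exists p.
have C1 : 0 < C + 1 by rewrite ltr_wpDl.
have /choice [B BP] : forall x, exists y, forall e : R, 0 < e ->
    exists p, [/\ G p, rnorm (x - p.1) < e & rnorm (y - p.2) < e].
  move=> x; pose r (k : nat) : R := k.+1%:R^-1.
  have /choice [u uP] : forall k, exists p, G p /\ rnorm (x - p.1) < r k.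
    move=> k; have [|p Gp xp] := dense x (r k); last by exists p.
    by rewrite invr_gt0 ltr0Sn.
  have rlim (eps : R) : 0 < eps -> exists N, forall k, (N <= k)%N -> r k < eps.
    move=> e0; exists (Num.truncn eps^-1) => k Nk.
    rewrite /r invf_plt ?posrE ?ltr0Sn //.
    by rewrite (lt_le_trans (truncnS_gt _)) // ler_nat ltnS.
  have [e e0|l lP] := @complete_rnorm R W (fun k => (u k).2).
    have [|N rN] := rlim (e / 2 / (C + 1)); first by rewrite !divr_gt0.
    exists N => m n Nm Nn; rewrite (le_lt_trans (GB _ _ (uP m).1 (uP n).1)) //.
    have := rN _ Nm; have := rN _ Nn; rewrite !ltr_pdivlMr //.
    have := rnorm_distD x (u m).1 (u n).1; rewrite (rnorm_distC _ x).
    have := (uP m).2; have := (uP n).2.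
    have := rnorm_ge0 ((u m).1 - (u n).1); nra.
  exists l => e e0; have [N1 h1] := lP _ e0; have [N2 h2] := rlim _ e0.
  exists (u (maxn N1 N2)); split; first exact: (uP _).1.
    by rewrite (lt_trans (uP _).2) // h2 // leq_maxr.
  by rewrite h1 // leq_maxl.
(* This one estimate yields the extension property ([x = p.1]), the norm bound ([p = 0]) and,
   applied to combinations of pairs, linearity. *)
have BC x p : G p -> rnorm (B x - p.2) <= C * rnorm (x - p.1).
  move=> Gp; apply/ler_addgt0Pr => e e0.
  have [|q [Gq xq Bq]] := BP x (e / (C + 1)); first by rewrite divr_gt0.
  have := rnorm_distD q.2 (B x) p.2; have := GB _ _ Gq Gp.
  have := rnorm_distD x q.1 p.1; rewrite (rnorm_distC _ x).
  move: xq Bq; rewrite !ltr_pdivlMr // => xq Bq h1 h2 h3.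
  have := ler_wpM2l C0 h1; nra.
have G0 : G (0, 0).
  have [p Gp _] := dense 0 1 ltr01.
  by have := GL (-1) _ _ Gp Gp; rewrite !scaleN1r !addNr.
have Bbound x : rnorm (B x) <= C * rnorm x by have := BC x _ G0; rewrite !subr0.
exists B; split=> //; last first.
  move=> p Gp; apply/eqP; rewrite -subr_eq0; apply/eqP/rnorm_eq0/eqP.
  by rewrite eq_le rnorm_ge0 andbT (le_trans (BC _ _ Gp)) // subrr rnorm0 mulr0.
apply: (bounded_op_intro (C := C)) => // a x y.
apply/eqP; rewrite -subr_eq0; apply/eqP/rnorm_eq0; apply: small_eq0 (rnorm_ge0 _) _ => e e0.
have p0 : 0 < (C + 1) * (rnorm a + 1) by rewrite mulr_gt0 // ltr_wpDl ?cnorm_ge0.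
(* The combination of the two approximating pairs misses the arguments by at most [(|a| + 1) d],
   which [B] multiplies by [C], and the values by at most [(|a| + 1) d]; the total is [e]. *)
pose d := e / ((C + 1) * (rnorm a + 1)).
have d0 : 0 < d by rewrite divr_gt0.
have [p [Gp xp Bp]] := BP x _ d0; have [q [Gq yq Bq]] := BP y _ d0.
have h1 := BC (a *: x + y) _ (GL a _ _ Gp Gq).
have lin V (u1 u2 v1 v2 : V) : rnorm (u1 - v1) < d -> rnorm (u2 - v2) < d ->
    rnorm ((a *: u1 + u2) - (a *: v1 + v2)) <= (rnorm a + 1) * d.
  move=> hu hv; rewrite (le_trans (rnorm_lin _ _ _ _ _)) // mulrDl mul1r.
  by rewrite lerD ?(ltW hv) // ler_wpM2l ?cnorm_ge0 ?ltW.
have h2 := ler_wpM2l C0 (lin _ _ _ _ _ xp yq).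
have h3 := lin _ _ _ _ _ Bp Bq.
have h4 := rnorm_distD (a *: p.2 + q.2) (B (a *: x + y)) (a *: B x + B y).
rewrite (rnorm_distC (a *: p.2 + q.2)) in h4.
have de : C * ((rnorm a + 1) * d) + (rnorm a + 1) * d = e.
  rewrite -{2}[(rnorm a + 1) * d]mul1r -mulrDl mulrA /d mulrC divfK // gt_eqF //.
move: h1 h2 h3 h4 => /=; lra.
Qed.

End BoundedOperations.

Section FamilyExtension.
Variables (R : realType) (I : eqType) (V : lmodType R[i]).

(** The family serves twice: with [J w a = a e_w] for the Fock space and with [J w h = e_w (x) h]
    for the tensor product. Indices are kept distinct so that Pythagoras computes the norm of a
    sum. *)
Definition family_sums (U : lmodType R[i]) (J : I -> V -> U) : set U :=
  [set x | exists (s : seq I) (h : I -> V), uniq s /\ x = \sum_(w <- s) J w (h w)].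

Lemma big_restrict (U : nmodType) (s t : seq I) (f : I -> U) :
  uniq s -> uniq t -> {subset s <= t} ->
  \sum_(w <- t) (if w \in s then f w else 0) = \sum_(w <- s) f w.
Proof.
move=> us ut st; rewrite -big_mkcond -big_filter; apply: perm_big.
apply: uniq_perm => [||w]; rewrite ?filter_uniq // mem_filter.
by apply/andP/idP => [[]|ws] //; split=> //; exact: st.
Qed.

(** The merged data [r], [l] do not depend on [J]. The same pair can therefore be used for arguments
    and for values, which keeps a graph of finite sums closed under linear combinations. *)
Lemma family_merge (s t : seq I) (h k : I -> V) (a : R[i]) : uniq s -> uniq t ->
  exists (r : seq I) (l : I -> V), uniq r /\
    forall (U : lmodType R[i]) (J : I -> V -> U), (forall w, linear (J w)) ->
      a *: \sum_(w <- s) J w (h w) + \sum_(w <- t) J w (k w) =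
      \sum_(w <- r) J w (l w).
Proof.
move=> us ut; exists (undup (s ++ t)).
exists (fun w => a *: (if w \in s then h w else 0) + (if w \in t then k w else 0)).
split=> [|U J JL]; first exact: undup_uniq.
under [RHS]eq_bigr do rewrite JL.
have J0 w : J w 0 = 0.
  by have := JL w (-1) 0 0; rewrite scaler0 addr0 scaleN1r addNr.
have restr (u : seq I) (f : I -> V) : uniq u -> {subset u <= s ++ t} ->
    \sum_(w <- undup (s ++ t)) J w (if w \in u then f w else 0) =
    \sum_(w <- u) J w (f w).
  move=> uu ust; rewrite -[RHS](@big_restrict _ u (undup (s ++ t))) ?undup_uniq //.
    by apply: eq_bigr => w _; case: ifP.
  by move=> w wu; rewrite mem_undup ust.
rewrite big_split -scaler_sumr !restr // => w wu; rewrite mem_cat wu ?orbT //.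
Qed.

Lemma family_sums_lin (U : lmodType R[i]) (J : I -> V -> U) :
  (forall w, linear (J w)) -> forall (a : R[i]) x y,
  family_sums J x -> family_sums J y -> family_sums J (a *: x + y).
Proof.
move=> JL a x y [s [h [us ->]]] [t [k [ut ->]]].
have [r [l [ur rE]]] := family_merge h k a us ut.
by exists r, l; rewrite rE.
Qed.

Lemma family_sums1 (U : lmodType R[i]) (J : I -> V -> U) w v : family_sums J (J w v).
Proof. by exists [:: w], (fun=> v); rewrite big_seq1. Qed.

Lemma family_extension (U : normedModType R[i]) (W : completeNormedModType R[i])
    (J : I -> V -> U) (g : I -> V -> W) (C : R) :
  (forall w, linear (J w)) -> (forall w, linear (g w)) -> 0 <= C ->
  (forall s h, uniq s -> rnorm (\sum_(w <- s) g w (h w)) <=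
                         C * rnorm (\sum_(w <- s) J w (h w))) ->
  closure (family_sums J) = setT ->
  exists B : U -> W, [/\ bounded_op B, forall x, rnorm (B x) <= C * rnorm x &
    forall w v, B (J w v) = g w v].
Proof.
move=> JL gL C0 gC Jd.
pose G : set (U * W) := [set p | exists (s : seq I) (h : I -> V),
  [/\ uniq s, p.1 = \sum_(w <- s) J w (h w) & p.2 = \sum_(w <- s) g w (h w)]].
have [|||B [bB BC BG]] := @bounded_extension R U W G C C0.
- move=> a p q [s [h [us -> ->]]] [t [k [ut -> ->]]].
  have [r [l [ur rE]]] := family_merge h k a us ut.
  by exists r, l; rewrite /= !rE.
- by move=> p [s [h [us -> ->]]]; exact: gC.
- rewrite -Jd; congr closure; apply/seteqP; split=> [_ [p [s [h [us pE _]]] <-]|x].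
    by exists s, h.
  move=> [s [h [us ->]]]; exists (\sum_(w <- s) J w (h w), \sum_(w <- s) g w (h w)) => //.
  by exists s, h.
exists B; split=> // w v; apply: (BG (_, _)); exists [:: w], (fun=> v).
by rewrite /= !big_seq1.
Qed.

End FamilyExtension.

(** * Orthogonal families and tensor products *)

Section OrthogonalFamilies.
Variables (R : realType) (U : hilbertType R) (I : eqType).

Lemma pythagoras_sum (s : seq I) (x : I -> U) : uniq s ->
  (forall v w, v != w -> hdot (x v) (x w) = 0) ->
  rnorm (\sum_(w <- s) x w) ^+ 2 = \sum_(w <- s) rnorm (x w) ^+ 2.
Proof.
move=> us xo; elim: s us => [|w s IHs] /= us; first by rewrite !big_nil rnorm0 expr0n.
rewrite !big_cons rnorm_pythagoras; first by rewrite IHs //; case/andP: us.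
rewrite hdot_sumr big_seq big1 // => v vs; apply: xo.
by apply: contraTneq us => ->; rewrite vs.
Qed.

Variables (V : lmodType R[i]) (J : I -> V -> U) (N : V -> R).
Hypotheses (JL : forall w, linear (J w)) (JN : forall w a, rnorm (J w a) = N a)
  (Jo : forall v w a b, v != w -> hdot (J v a) (J w b) = 0)
  (Jd : closure (family_sums J) = setT).

Lemma rnorm_family_sum (s : seq I) (h : I -> V) : uniq s ->
  rnorm (\sum_(w <- s) J w (h w)) ^+ 2 = \sum_(w <- s) N (h w) ^+ 2.
Proof.
move=> us; rewrite pythagoras_sum // => [|v w vw]; last exact: Jo.
by apply: eq_bigr => w _; rewrite JN.
Qed.

(** Injectivity of [f] keeps the images of distinct lines orthogonal, so the bound is checked term
    by term. Shifts are the case [f = cons i], diagonal operators the case [f = id]. *)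
Lemma weighted_map (f : I -> I) (d : I -> R[i]) (C : R) : injective f -> 0 <= C ->
  (forall w, rnorm (d w) <= C) ->
  exists B : U -> U, [/\ bounded_op B, forall x, rnorm (B x) <= C * rnorm x &
    forall w v, B (J w v) = d w *: J (f w) v].
Proof.
move=> fI C0 dC; apply: (family_extension (J := J)) => //.
  by move=> w a x y; rewrite JL scalerDr !scalerA mulrC.
move=> s h us; rewrite -ler_sqr ?nnegrE ?mulr_ge0 ?rnorm_ge0 //.
rewrite exprMn rnorm_family_sum // pythagoras_sum // => [|v w vw]; last first.
  by rewrite hdotZl hdotZr Jo ?mulr0 // (inj_eq fI).
rewrite mulr_sumr; apply: ler_sum => w _; rewrite rnormZ exprMn JN.
by rewrite ler_wpM2r ?sqr_ge0 // ler_sqr ?nnegrE ?cnorm_ge0.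
Qed.

Lemma family_eq (W : normedModType R[i]) (f g : U -> W) : bounded_op f -> bounded_op g ->
  (forall w v, f (J w v) = g (J w v)) -> f = g.
Proof.
move=> bf bg fg; apply: (@dense_eq _ _ _ f g [set J w.1 w.2 | w in setT]) => //.
  rewrite -subTset -Jd; apply: closure_subset => _ [s [h [us ->]]].
  exists (size s), (fun=> 1), (fun i => J (tnth (in_tuple s) i) (h (tnth (in_tuple s) i))).
  split=> [i|]; first by exists (tnth (in_tuple s) i, h (tnth (in_tuple s) i)).
  by rewrite big_tnth; apply: eq_bigr => i _; rewrite scale1r.
by move=> _ [[w v] _ <-] /=.
Qed.

Lemma diagonal_bound (D : U -> U) (d : I -> R[i]) (C : R) : bounded_op D -> 0 <= C ->
  (forall w v, D (J w v) = d w *: J w v) -> (forall w, rnorm (d w) <= C) ->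
  forall x, rnorm (D x) <= C * rnorm x.
Proof.
move=> bD C0 DJ dC.
have [B [bB BC BJ]] := @weighted_map id d C (@inj_id _) C0 dC.
by have -> : D = B by apply: family_eq => // w v; rewrite DJ BJ.
Qed.

End OrthogonalFamilies.

Section Bases.
Variables (R : realType) (I : eqType).

Lemma family_sums_lspan (V : lmodType R[i]) (U : normedModType R[i]) (J : I -> V -> U) S :
  (forall w, linear (J w)) -> S `<=` closure (family_sums J) ->
  closure (lspan S) = setT -> closure (family_sums J) = setT.
Proof.
move=> JL SJ cS; rewrite -subTset -cS.
have cl : closed (closure (family_sums J)) by exact: closed_closure.
rewrite [X in _ `<=` X](closure_id _).1 //.
apply: closure_subset => _ [k [a [y [Sy ->]]]].
have clin := closure_lin (family_sums_lin JL).
elim/big_ind: _ => [|u v hu hv|i _].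
- apply: subset_closure; exists [::], (fun=> 0); split=> //.
  by rewrite big_nil.
- by rewrite -[u]scale1r; apply: clin.
rewrite -[_ *: _]addr0; apply: clin; first exact: SJ.
apply: subset_closure; exists [::], (fun=> 0); split=> //.
by rewrite big_nil.
Qed.

Variables (F : hilbertType R) (e : I -> F).
Hypothesis he : orthonormal_basis e.

(** [R[i]^o] is the scalar field as a module over itself, which makes scalar coefficients an
    instance of the [V]-valued families above. *)
Definition basis_line (w : I) (a : R[i]^o) : F := a *: e w.

Lemma basis_line_linear w : linear (basis_line w).
Proof. by move=> a x y; rewrite /basis_line scalerDl -scalerA. Qed.

Lemma rnorm_basis w : rnorm (e w) = 1.
Proof.
have := congr1 (@complex.Re R) (hdotxx (e w)).
rewrite he.1 eqxx /= => /esym/eqP; rewrite sqrf_eq1 => /orP [/eqP//|/eqP h].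
by have := rnorm_ge0 (e w); rewrite h oppr_ge0 ler10.
Qed.

Lemma rnorm_basis_line w a : rnorm (basis_line w a) = rnorm (a : R[i]).
Proof. by rewrite rnormZ rnorm_basis mulr1. Qed.

Lemma basis_line_orth v w a b : v != w -> hdot (basis_line v a) (basis_line w b) = 0.
Proof. by move=> /negbTE vw; rewrite hdotZl hdotZr he.1 vw !mulr0. Qed.

Lemma basis_line_dense : closure (family_sums basis_line) = setT.
Proof.
apply: family_sums_lspan basis_line_linear _ he.2 => _ [w _ <-].
apply: subset_closure; rewrite -[e w]scale1r.
exact: (family_sums1 basis_line w 1).
Qed.

Variables (H K : hilbertType R) (tens : {bilinear F -> H -> K}).
Hypothesis htens : hilbert_tensor tens.

Definition tens_line (w : I) (h : H) : K := tens (e w) h.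

Lemma tens_line_linear w : linear (tens_line w).
Proof. by move=> a x y; rewrite /tens_line linearPr. Qed.

Lemma rnorm_tens f h : rnorm (tens f h) = rnorm f * rnorm h.
Proof.
apply/eqP; rewrite -(@eqrXn2 _ 2) ?mulr_ge0 ?rnorm_ge0 //; apply/eqP.
by apply: complexI; rewrite -hdotxx htens.1 !hdotxx -rmorphM exprMn.
Qed.

Lemma rnorm_tens_line w h : rnorm (tens_line w h) = rnorm h.
Proof. by rewrite rnorm_tens rnorm_basis mul1r. Qed.

Lemma tens_line_orth v w a b : v != w -> hdot (tens_line v a) (tens_line w b) = 0.
Proof. by move=> /negbTE vw; rewrite htens.1 he.1 vw mul0r. Qed.

Lemma bounded_op_tensl h : bounded_op (fun f => tens f h).
Proof.
apply: (bounded_op_intro (C := rnorm h)) => [a x y|x]; first exact: linearPl.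
by rewrite rnorm_tens mulrC.
Qed.

Lemma bounded_op_tensr f : bounded_op (tens f).
Proof.
apply: (bounded_op_intro (C := rnorm f)) => [a x y|x]; first exact: linearPr.
by rewrite rnorm_tens.
Qed.

(** Only the left factor of an elementary tensor needs approximating by basis vectors; [h] is
    absorbed into the coefficients. *)
Lemma tens_line_dense : closure (family_sums tens_line) = setT.
Proof.
apply: family_sums_lspan tens_line_linear _ htens.2 => _ [[f h] _ <-] /=.
have [C C0 hC] := bounded_op_bound (bounded_op_tensl h).
have [_ _ tB _] := bounded_op_linear (bounded_op_tensl h).
apply/closureP => eps eps0.
have C1 : 0 < C + 1 by rewrite ltr_wpDl.
have /closureP /(_ (eps / (C + 1))) : closure (family_sums basis_line) f.
  by rewrite basis_line_dense.
rewrite divr_gt0 // => /(_ isT) [_ [s [a [us ->]]] fs].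
exists (\sum_(w <- s) tens_line w (a w *: h)); first by exists s, (fun w => a w *: h).
have -> : \sum_(w <- s) tens_line w (a w *: h) = tens (\sum_(w <- s) basis_line w (a w)) h.
  rewrite linear_sumlz; apply: eq_bigr => w _.
  by rewrite /tens_line /basis_line linearZl_LR linearZr_LR.
rewrite -tB (le_lt_trans (hC _)) //; move: fs; rewrite ltr_pdivlMr //; apply: le_lt_trans.
by rewrite mulrC ler_wpM2l ?rnorm_ge0 // lerDl.
Qed.

Lemma tens_eq (W : normedModType R[i]) (f g : K -> W) : bounded_op f -> bounded_op g ->
  (forall w h, f (tens (e w) h) = g (tens (e w) h)) -> f = g.
Proof.
by move=> bf bg fg; apply: (family_eq tens_line_dense bf bg) => w v; exact: fg.
Qed.

Lemma basis_eq (W : normedModType R[i]) (f g : F -> W) : bounded_op f -> bounded_op g ->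
  (forall w, f (e w) = g (e w)) -> f = g.
Proof.
move=> bf bg fg; apply: (family_eq basis_line_dense bf bg) => w v.
have [_ _ _ fZ] := bounded_op_linear bf; have [_ _ _ gZ] := bounded_op_linear bg.
by rewrite /basis_line fZ gZ fg.
Qed.

(** [ampliation] is a choice among the operators with a given action on elementary tensors, so its
    value is known only after one such operator has been exhibited. *)
Lemma ampliation_unique (A : F -> F) (B : K -> K) : bounded_op B ->
  (forall f h, B (tens f h) = tens (A f) h) -> ampliation tens A = B.
Proof.
move=> bB BA.
have [bG GA] : bounded_op (ampliation tens A) /\
    forall f h, ampliation tens A (tens f h) = tens (A f) h.
  apply: (@getPex _ [set B : K -> K |
    bounded_op B /\ forall x h, B (tens x h) = tens (A x) h]).
  by exists B.
by apply: tens_eq => // w h; rewrite GA BA.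
Qed.

Lemma ampliation_adjoint (A : F -> F) (B : K -> K) : bounded_op A -> bounded_op B ->
  (forall f h, B (tens f h) = tens (A f) h) ->
  ampliation tens (adjoint A) = adjoint B.
Proof.
move=> bA bB BA; have [bA' hA] := adjointP bA; have [bB' hB] := adjointP bB.
apply: ampliation_unique => // f h.
have dense : closure (lspan [set tens u.1 u.2 | u in [set: F * H]]) = setT.
  exact: htens.2.
(* The conjugate makes the functional linear in [y], so the density principle for bounded operators
   applies to it. *)
pose r (x : K) (y : K) : R[i]^o := Num.conj (hdot x y).
have rb x : bounded_op (r x : K -> R[i]^o).
  apply: (bounded_op_intro (C := rnorm x)) => [a y z|y].
    by rewrite /r hdotDr hdotZr rmorphD rmorphM /= conjCK.
  by rewrite cnorm_conj cauchy_schwarz.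
apply: hdot_inj => y; apply: (can_inj (@conjCK _)).
rewrite -[LHS]/(r (adjoint B (tens f h)) y) -[RHS]/(r (tens (adjoint A f) h) y).
congr (_ y); apply: (dense_eq (rb _) (rb _) dense) => _ [[g k] _ <-] /=.
by rewrite /r -!hdotC -hB BA !htens.1 hA.
Qed.

End Bases.

(** * Row sums of words *)

Lemma sum_cauchy_schwarz (R : realType) I (s : seq I) (a b : I -> R) :
  (forall i, 0 <= a i) -> (forall i, 0 <= b i) ->
  (\sum_(i <- s) a i * b i) ^+ 2 <=
  (\sum_(i <- s) a i ^+ 2) * (\sum_(i <- s) b i ^+ 2).
Proof.
move=> a0 b0; elim: s => [|i s]; first by rewrite !big_nil expr0n mulr0.
rewrite !big_cons; set S := \sum_(_ <- s) _ * _; set A := \sum_(_ <- s) a _ ^+ 2.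
set B := \sum_(_ <- s) b _ ^+ 2 => IH.
have S0 : 0 <= S by apply: sumr_ge0 => j _; rewrite mulr_ge0.
have A0 : 0 <= A by apply: sumr_ge0 => j _; rewrite sqr_ge0.
have B0 : 0 <= B by apply: sumr_ge0 => j _; rewrite sqr_ge0.
move: (a i) (b i) (a0 i) (b0 i) => x y x0 y0.
(* With [S^2 <= A B] from the induction, the squared sides differ by at least
   [(A y^2 - B x^2)^2]. *)
have : 2 * S * (x * y) <= A * y ^+ 2 + B * x ^+ 2.
  rewrite -ler_sqr ?nnegrE ?addr_ge0 ?mulr_ge0 ?sqr_ge0 //.
  have h : (2 * S * (x * y)) ^+ 2 <= 4 * (A * B) * (x * y) ^+ 2.
    by rewrite exprMn ler_wpM2r ?sqr_ge0 // exprMn; lra.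
  apply: le_trans h _; rewrite -subr_ge0.
  by rewrite (_ : _ - _ = (A * y ^+ 2 - B * x ^+ 2) ^+ 2) ?sqr_ge0 //; ring.
by move=> h; nra.
Qed.

Section WordSums.
Variables (R : realType) (n : nat).
Implicit Types f : seq 'I_n -> R.

Lemma big_tupleS (V : nmodType) k (f : seq 'I_n -> V) :
  \sum_(w : k.+1.-tuple 'I_n) f w = \sum_i \sum_(w : k.-tuple 'I_n) f (i :: w).
Proof.
rewrite pair_big /= (reindex (fun p : 'I_n * k.-tuple 'I_n => [tuple of p.1 :: p.2])) //=.
exists (fun w => (thead w, [tuple of behead w])) => [[i w] _|w _] /=.
  by congr (_, _); apply: val_inj.
by rewrite [RHS](tuple_eta w).
Qed.

(** A finite set of words is completed to full length levels, the only sums that [rowsum]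
    controls. *)
Lemma sum_words_le (s : seq (seq 'I_n)) f : uniq s -> (forall w, 0 <= f w) ->
  exists N, \sum_(w <- s) f w <= \sum_(k < N) \sum_(w : k.-tuple 'I_n) f w.
Proof.
move=> us f0; pose N := (\max_(w <- s) size w).+1; exists N.
have -> : \sum_(w <- s) f w = \sum_(k < N) \sum_(w <- s | size w == k) f w.
  rewrite (exchange_big_dep predT) //= [LHS]big_seq [RHS]big_seq.
  apply: eq_bigr => w ws.
  have wN : (size w < N)%N by rewrite ltnS (leq_bigmax_seq (F := size)).
  by rewrite (big_pred1 (Ordinal wN)) // => k; rewrite -val_eqE eq_sym.
apply: ler_sum => k _; rewrite -big_filter.
pose t := [seq val w | w <- enum {: k.-tuple 'I_n}].
have tE (g : seq 'I_n -> R) : \sum_(w : k.-tuple 'I_n) g w = \sum_(w <- t) g w.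
  by rewrite big_map big_enum.
rewrite tE -[leLHS](@big_restrict _ R _ t) ?filter_uniq //.
- by apply: ler_sum => w _; case: ifP.
- by rewrite map_inj_uniq ?enum_uniq //; exact: val_inj.
- move=> w; rewrite mem_filter => /andP [wk _]; apply/mapP.
  by exists (Tuple wk); rewrite ?mem_enum.
Qed.

End WordSums.

Section RowSums.
Variables (R : realType) (n : nat) (H : hilbertType R) (T : 'I_n -> H -> H).
Hypothesis hT : forall i, bounded_op (T i).

Lemma bounded_op_word w : bounded_op (opword T w).
Proof. by elim: w => [|i w IHw]; [exact: bounded_op_id|exact: bounded_op_comp]. Qed.

Lemma adjoint_word_cons i w :
  adjoint (opword T (i :: w)) = adjoint (opword T w) \o adjoint (T i).
Proof.
apply: adjoint_unique => [|x y]; first exact: bounded_op_word.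
by rewrite /= (adjointP (hT i)).2 (adjointP (bounded_op_word w)).2.
Qed.

Lemma adjoint_word0 : adjoint (opword T [::]) = id.
Proof. by apply: adjoint_unique => //; exact: bounded_op_id. Qed.

Lemma bounded_op_rowsum k : bounded_op (rowsum T k).
Proof.
apply: bounded_op_sum => w; apply: bounded_op_comp; first exact: bounded_op_word.
by case: (adjointP (bounded_op_word w)).
Qed.

(** The quadratic form of the positive operator [rowsum T k]; as a sum of squares it replaces the
    order on operators. *)
Definition rowform k (h : H) : R :=
  \sum_(w : k.-tuple 'I_n) rnorm (adjoint (opword T w) h) ^+ 2.

Lemma rowform_ge0 k h : 0 <= rowform k h.
Proof. by apply: sumr_ge0 => w _; exact: sqr_ge0. Qed.

Lemma sum_funE (U V : lmodType R[i]) (I : Type) (r : seq I) (f : I -> U -> V) x :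
  (\sum_(i <- r) f i) x = \sum_(i <- r) f i x.
Proof. by elim/big_rec2: _ => // i y g _ <-. Qed.

Lemma hdot_rowsum k h g : hdot (rowsum T k h) g =
  \sum_(w : k.-tuple 'I_n) hdot (adjoint (opword T w) h) (adjoint (opword T w) g).
Proof.
rewrite /rowsum sum_funE hdot_suml; apply: eq_bigr => w _.
by rewrite /= (adjointP (bounded_op_word w)).2.
Qed.

Lemma rowform_le k h : rowform k h <= opnorm (rowsum T k) * rnorm h ^+ 2.
Proof.
have -> : rowform k h = complex.Re (hdot (rowsum T k h) h).
  rewrite hdot_rowsum; under eq_bigr do rewrite hdotxx.
  by rewrite -rmorph_sum.
rewrite (le_trans (Re_le_cnorm _)) // (le_trans (cauchy_schwarz _ _)) //.
by rewrite expr2 mulrA ler_wpM2r ?rnorm_ge0 // opnormP //; exact: bounded_op_rowsum.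
Qed.

(** Cauchy-Schwarz for the sesquilinear form [<rowsum T k h, g>]: the norm of a positive operator is
    controlled by its quadratic form. *)
Lemma opnorm_rowsum_le k (C : R) : 0 <= C ->
  (forall h, rowform k h <= C * rnorm h ^+ 2) -> opnorm (rowsum T k) <= C.
Proof.
move=> C0 hC; apply: opnorm_le => // h.
apply: rnorm_le_hdot => [|g]; first by rewrite mulr_ge0 ?rnorm_ge0.
rewrite hdot_rowsum (le_trans (rnorm_sum (V := R[i]^o) _ _ _)) //.
pose a w := rnorm (adjoint (opword T w) h); pose b w := rnorm (adjoint (opword T w) g).
apply: (@le_trans _ _ (\sum_(w : k.-tuple 'I_n) a w * b w)).
  by apply: ler_sum => w _; exact: cauchy_schwarz.
have ab0 : 0 <= \sum_(w : k.-tuple 'I_n) a w * b w.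
  by apply: sumr_ge0 => w _; rewrite mulr_ge0 ?rnorm_ge0.
rewrite -ler_sqr ?nnegrE ?mulr_ge0 ?rnorm_ge0 //.
rewrite (le_trans (sum_cauchy_schwarz _ _ _)) //; try by move=> w; exact: rnorm_ge0.
have -> : (C * rnorm h * rnorm g) ^+ 2 = (C * rnorm h ^+ 2) * (C * rnorm g ^+ 2) by ring.
by apply: ler_pM; rewrite ?rowform_ge0 ?hC.
Qed.

Lemma rowform0 h : rowform 0 h = rnorm h ^+ 2.
Proof.
rewrite /rowform (big_pred1 [tuple]) /= => [|w]; first by rewrite adjoint_word0.
by rewrite [w]tuple0; apply/esym/eqP.
Qed.

Lemma rowformS k h : rowform k.+1 h = \sum_i rowform k (adjoint (T i) h).
Proof.
rewrite /rowform (big_tupleS k (fun w => rnorm (adjoint (opword T w) h) ^+ 2)).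
by apply: eq_bigr => i _; apply: eq_bigr => w _; rewrite adjoint_word_cons.
Qed.

(** A word of length [j + k] splits uniquely after [j] letters, so [rowsum T (j + k)] is the sum
    over [|v| = j] of [T_v (rowsum T k) T_v^*]. *)
Lemma rowform_add j k h : rowform (j + k) h <= opnorm (rowsum T k) * rowform j h.
Proof.
elim: j h => [|j IHj] h; first by rewrite add0n rowform0 rowform_le.
by rewrite addSn !rowformS mulr_sumr; apply: ler_sum.
Qed.

Lemma opnorm_rowsum_ge0 k : 0 <= opnorm (rowsum T k).
Proof. exact/opnorm_ge0/bounded_op_rowsum. Qed.

Lemma opnorm_rowsum_add j k :
  opnorm (rowsum T (j + k)) <= opnorm (rowsum T j) * opnorm (rowsum T k).
Proof.
apply: opnorm_rowsum_le => [|h]; first by rewrite mulr_ge0 ?opnorm_rowsum_ge0.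
rewrite (le_trans (rowform_add _ _ _)) // [_ * opnorm _]mulrC -mulrA.
by rewrite ler_wpM2l ?opnorm_rowsum_ge0 // rowform_le.
Qed.

Lemma opnorm_rowsum0 : (exists h : H, h != 0) -> opnorm (rowsum T 0) = 1.
Proof.
move=> [h h0]; apply/eqP; rewrite eq_le; apply/andP; split.
  by apply: opnorm_rowsum_le => // g; rewrite rowform0 mul1r.
have := rowform_le 0 h; rewrite rowform0 ler_pMl //.
by rewrite exprn_gt0 // lt_neqAle rnorm_ge0 andbT eq_sym; apply: contra_neq h0 => /rnorm_eq0.
Qed.

(** A sum of positive operators vanishes only if every summand does; nilpotency can thus be read off
    the numbers [opnorm (rowsum T k)]. *)
Lemma vanishes_opnorm k : vanishes_at_length T k <-> opnorm (rowsum T k) = 0.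
Proof.
split=> [Tk|Tk w wk].
  apply/eqP; rewrite eq_le opnorm_rowsum_ge0 andbT; apply: opnorm_rowsum_le => // h.
  rewrite mul0r /rowform big1 // => w _; rewrite (Tk w (size_tuple w)).
  rewrite (@adjoint_unique _ _ _ (0 : H -> H) (0 : H -> H)); last first.
  - by move=> x y; transitivity (0 : R[i]); [exact: hdot0l|exact/esym/hdot0r].
  - exact: bounded_op0.
  by have -> : (0 : H -> H) h = 0 by []; rewrite rnorm0 expr0n.
apply/funext => h; apply: hdot_inj => g.
transitivity (0 : R[i]); last exact/esym/hdot0l.
rewrite (adjointP (bounded_op_word w)).2.
have /eqP := rowform_le k g; rewrite Tk mul0r => hg.
have : rowform k g = 0 by apply/eqP; rewrite eq_le rowform_ge0 andbT; apply/eqP.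
move/eqP; rewrite psumr_eq0 => [/allP /(_ (Tuple (introT eqP wk)))|v _]; last exact: sqr_ge0.
rewrite mem_index_enum => /(_ isT) /=; rewrite sqrf_eq0 => /eqP /rnorm_eq0 ->.
by rewrite hdot0r.
Qed.

(** The row operator with entries [c_|w| T_w] is bounded by duality: pairing with [y] moves each
    word to its adjoint, and the squares of the resulting norms add up to [c k ^+ 2 * rowform k y]
    on each level. This is what makes [Y] bounded. *)
Lemma weighted_row_bound (c : nat -> R) (C : R) (s : seq (seq 'I_n))
    (h : seq 'I_n -> H) : (forall k, 0 <= c k) -> 0 <= C ->
  (forall N, \sum_(k < N) c k ^+ 2 * opnorm (rowsum T k) <= C ^+ 2) -> uniq s ->
  rnorm (\sum_(w <- s) (c (size w))%:C *: opword T w (h w)) ^+ 2 <=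
  C ^+ 2 * \sum_(w <- s) rnorm (h w) ^+ 2.
Proof.
move=> c0 C0 cC us.
have S0 : 0 <= \sum_(w <- s) rnorm (h w) ^+ 2 by apply: sumr_ge0 => w _; exact: sqr_ge0.
rewrite -(sqr_sqrtr S0) -exprMn ler_sqr ?nnegrE ?mulr_ge0 ?sqrtr_ge0 ?rnorm_ge0 //.
apply: rnorm_le_hdot => [|y]; first by rewrite mulr_ge0 ?sqrtr_ge0.
rewrite hdot_suml (le_trans (rnorm_sum (V := R[i]^o) _ _ _)) //.
pose b w := c (size w) * rnorm (adjoint (opword T w) y).
apply: (@le_trans _ _ (\sum_(w <- s) rnorm (h w) * b w)).
  apply: ler_sum => w _; rewrite hdotZl (adjointP (bounded_op_word w)).2.
  rewrite (cnormM _ _) cnorm_real ger0_norm // /b mulrCA ler_wpM2l //.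
  exact: cauchy_schwarz.
have b0 w : 0 <= b w by rewrite mulr_ge0 ?rnorm_ge0.
rewrite -ler_sqr ?nnegrE ?mulr_ge0 ?sqrtr_ge0 ?rnorm_ge0 //; last first.
  by apply: sumr_ge0 => w _; rewrite mulr_ge0 ?rnorm_ge0.
rewrite (le_trans (sum_cauchy_schwarz _ _ _)) //; first by move=> w; exact: rnorm_ge0.
rewrite !exprMn sqr_sqrtr // [C ^+ 2 * _]mulrC -mulrA ler_wpM2l //.
have [|N sN] := @sum_words_le R n s (fun w => b w ^+ 2) us; first by move=> w; exact: sqr_ge0.
rewrite (le_trans sN) // (le_trans _ (ler_wpM2r (sqr_ge0 (rnorm y)) (cC N))) //.
rewrite mulr_suml; apply: ler_sum => k _; rewrite -mulrA.
rewrite (le_trans _ (ler_wpM2l (sqr_ge0 (c k)) (rowform_le k y))) // mulr_sumr.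
by apply: ler_sum => w _; rewrite /b size_tuple exprMn.
Qed.

End RowSums.

(** * Complete boundedness *)

Section GramSchmidt.
Variables (R : realType) (H : hilbertType R).

(** The system is indexed by [nat] below a bound, so that adjoining a vector needs no change of
    index type. *)
Lemma gram_schmidt (hs : seq H) : exists (m : nat) (u : nat -> H),
  (forall a b, (a < m)%N -> (b < m)%N -> hdot (u a) (u b) = (a == b)%:R) /\
  forall h, h \in hs -> exists z : nat -> R[i], h = \sum_(b < m) z b *: u b.
Proof.
elim: hs => [|h hs [m [u [uo uz]]]]; first by exists 0%N, (fun=> 0).
pose r := h - \sum_(b < m) hdot h (u b) *: u b.
have ro a : (a < m)%N -> hdot r (u a) = 0.
  move=> am; rewrite hdotBl hdot_suml (bigD1 (Ordinal am)) //= hdotZl uo // eqxx mulr1.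
  rewrite big1 ?addr0 ?subrr // => b; rewrite -val_eqE /= => ba.
  by rewrite hdotZl uo // (negbTE ba) mulr0.
have hr : h = \sum_(b < m) hdot h (u b) *: u b + r by rewrite addrC subrK.
have [r0|r0] := eqVneq r 0.
  exists m, u; split=> // g; rewrite inE => /orP [/eqP ->|/uz//].
  by exists (fun b => hdot h (u b)); rewrite {1}hr r0 addr0.
have n0 : rnorm r != 0 by apply: contra_neq r0 => /rnorm_eq0.
pose v (a : nat) := if a == m then (rnorm r)^-1%:C *: r else u a.
have vm : v m = (rnorm r)^-1%:C *: r by rewrite /v eqxx.
have vu a : (a < m)%N -> v a = u a by move=> am; rewrite /v ltn_eqF.
have vsum (z : nat -> R[i]) : \sum_(b < m) z b *: v b = \sum_(b < m) z b *: u b.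
  by apply: eq_bigr => b _; rewrite vu.
exists m.+1, v; split=> [a b|g].
  rewrite !ltnS leq_eqVlt => /orP [/eqP ->|am]; rewrite leq_eqVlt => /orP [/eqP ->|bm].
  - rewrite vm hdotZl hdotZr hdotxx eqxx -[Num.conj _]/(conjc _) conjc_real.
    by rewrite -!rmorphM /= mulrA -expr2 -exprMn mulVf // expr1n.
  - by rewrite vm vu // hdotZl ro // mulr0 gtn_eqF.
  - by rewrite vm vu // hdotZr hdotC ro // rmorph0 mulr0 ltn_eqF.
  - by rewrite !vu // uo.
rewrite inE => /orP [/eqP ->|/uz [z gz]]; last first.
  exists (fun b => if b == m then 0 else z b).
  rewrite big_ord_recr /= eqxx scale0r addr0 gz -(vsum z); apply: eq_bigr => b _.
  by rewrite ltn_eqF.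
exists (fun b => if b == m then (rnorm r)%:C else hdot h (u b)).
rewrite big_ord_recr /= eqxx vm scalerA -rmorphM /= mulfV // scale1r {1}hr.
congr (_ + r); rewrite -(vsum (fun b => hdot h (u b))); apply: eq_bigr => b _.
by rewrite ltn_eqF.
Qed.

Lemma rnorm_orthonormal_sum m (u : nat -> H) (z : nat -> R[i]) :
  (forall a b, (a < m)%N -> (b < m)%N -> hdot (u a) (u b) = (a == b)%:R) ->
  rnorm (\sum_(b < m) z b *: u b) ^+ 2 = \sum_(b < m) rnorm (z b) ^+ 2.
Proof.
move=> uo; rewrite (@pythagoras_sum _ _ _ (index_enum 'I_m) (fun b => z b *: u b)).
- apply: eq_bigr => b _; rewrite rnormZ exprMn.
  have -> : rnorm (u b) ^+ 2 = 1; last by rewrite mulr1.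
  by apply: complexI; rewrite -hdotxx uo ?eqxx.
- exact: index_enum_uniq.
- by move=> a b ab; rewrite hdotZl hdotZr uo // val_eqE (negbTE ab) !mulr0.
Qed.

End GramSchmidt.

Section VectorNorm.
Variables (R : realType) (V : normedModType R[i]) (k : nat).

Lemma vecnorm_sq (x : 'I_k -> V) : vecnorm x ^+ 2 = \sum_i rnorm (x i) ^+ 2.
Proof. by rewrite sqr_sqrtr // sumr_ge0 // => i _; exact: sqr_ge0. Qed.

Lemma vecnorm_ge0 (x : 'I_k -> V) : 0 <= vecnorm x.
Proof. exact: sqrtr_ge0. Qed.

Lemma rnorm_le_vecnorm (x : 'I_k -> V) j : rnorm (x j) <= vecnorm x.
Proof.
rewrite -ler_sqr ?nnegrE ?rnorm_ge0 ?vecnorm_ge0 // vecnorm_sq (bigD1 j) //= lerDl.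
by apply: sumr_ge0 => i _; exact: sqr_ge0.
Qed.

Lemma vecnorm_scale (r : R) (x : 'I_k -> V) : 0 <= r ->
  vecnorm (fun i => r%:C *: x i) = r * vecnorm x.
Proof.
move=> r0; apply/eqP; rewrite -(@eqrXn2 _ 2) ?mulr_ge0 ?vecnorm_ge0 //; apply/eqP.
rewrite exprMn !vecnorm_sq mulr_sumr; apply: eq_bigr => i _.
by rewrite rnorm_real_scale // exprMn.
Qed.

End VectorNorm.

Section MatrixNorm.
Variables (R : realType) (U V : normedModType R[i]) (k : nat).

Lemma mx_contraction (A : 'I_k -> 'I_k -> U -> V) (x : 'I_k -> U) :
  (forall i j, bounded_op (A i j)) -> mxopnorm A <= 1 ->
  \sum_i rnorm (\sum_j A i j (x j)) ^+ 2 <= \sum_j rnorm (x j) ^+ 2.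
Proof.
move=> bA A1; pose f (y : 'I_k -> U) := fun i => \sum_j A i j (y j).
(* The supremum of an unbounded set is a default value, so [mxopnorm A <= 1] carries information
   only once boundedness is known; it follows from the norms of the entries. *)
have ub : has_sup [set vecnorm (f y) | y in [set y : 'I_k -> U | vecnorm y <= 1]].
  split.
    exists (vecnorm (f (fun=> 0))); exists (fun=> 0) => //=.
    rewrite -ler_sqr ?nnegrE ?vecnorm_ge0 // vecnorm_sq big1 ?expr1n // => i _.
    by rewrite rnorm0 expr0n.
  exists (Num.sqrt (\sum_i (\sum_j opnorm (A i j)) ^+ 2)) => _ [y /= y1 <-].
  apply: ler_wsqrtr; apply: ler_sum => i _.
  have S0 : 0 <= \sum_j opnorm (A i j) by apply: sumr_ge0 => j _; exact: opnorm_ge0.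
  rewrite ler_sqr ?nnegrE ?rnorm_ge0 // (le_trans (rnorm_sum _ _ _)) //.
  apply: ler_sum => j _; rewrite (le_trans (opnormP _ (bA i j))) // ler_piMr ?opnorm_ge0 //.
  by rewrite (le_trans (rnorm_le_vecnorm _ _)).
rewrite -!vecnorm_sq ler_sqr ?nnegrE ?vecnorm_ge0 //.
have [x0|x0] := eqVneq (vecnorm x) 0.
  have xj j : x j = 0.
    by apply: rnorm_eq0; apply/eqP; rewrite eq_le rnorm_ge0 andbT -x0 rnorm_le_vecnorm.
  rewrite x0 -[leRHS](mulr0 0) -[leRHS]expr2 -ler_sqr ?nnegrE ?vecnorm_ge0 ?sqr_ge0 //.
  rewrite vecnorm_sq big1 ?sqr_ge0 // => i _.
  rewrite big1 ?rnorm0 ?expr0n // => j _.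
  by rewrite xj; have [-> _ _ _] := bounded_op_linear (bA i j).
have n0 : 0 < vecnorm x by rewrite lt_neqAle eq_sym x0 vecnorm_ge0.
have i0 : 0 <= (vecnorm x)^-1 by rewrite invr_ge0 ltW.
pose y j := (vecnorm x)^-1%:C *: x j.
have : vecnorm (f y) <= 1.
  rewrite (le_trans _ A1) //; apply: sup_upper_bound => //; exists y => //=.
  by rewrite vecnorm_scale // mulVf.
have -> : f y = fun i => (vecnorm x)^-1%:C *: \sum_j A i j (x j).
  apply/funext => i; rewrite scaler_sumr; apply: eq_bigr => j _.
  by have [_ _ _ ->] := bounded_op_linear (bA i j).
by rewrite vecnorm_scale // ler_pdivrMl // mulr1.
Qed.

End MatrixNorm.

Section CompletelyBounded.
Variables (R : realType) (F H K : hilbertType R) (tens : {bilinear F -> H -> K}).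
Hypothesis htens : hilbert_tensor tens.
Variables (Y : K -> H) (C : R) (e0 : F).
Hypotheses (bY : bounded_op Y) (C0 : 0 <= C) (YC : forall x, rnorm (Y x) <= C * rnorm x)
  (e01 : rnorm e0 = 1).

Definition tensor_calculus (A : F -> F) : H -> H := fun h => Y (tens (A e0) h).

(** The matrix with entries [A i j (x) 1] is a contraction whenever the matrix [A] is. Expanding the
    [x j] in an orthonormal system [u] of [H] splits the left side into orthogonal parts, one for
    each [u b], and [A] contracts each of them. *)
Lemma tensor_row_bound k (A : 'I_k -> 'I_k -> F -> F) (x : 'I_k -> H) :
  (forall i j, bounded_op (A i j)) -> mxopnorm A <= 1 ->
  \sum_i rnorm (\sum_j tens (A i j e0) (x j)) ^+ 2 <= \sum_j rnorm (x j) ^+ 2.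
Proof.
move=> bA A1.
have [m [u [uo uz]]] := gram_schmidt (codom x).
have /choice [z xz] : forall j, exists z : nat -> R[i], x j = \sum_(b < m) z b *: u b.
  by move=> j; apply: uz; exact: codom_f.
have -> : \sum_j rnorm (x j) ^+ 2 = \sum_(b < m) \sum_j rnorm (z j b *: e0) ^+ 2.
  rewrite exchange_big; apply: eq_bigr => j _; rewrite xz rnorm_orthonormal_sum //.
  by apply: eq_bigr => b _; rewrite rnormZ e01 mulr1.
pose a i (b : nat) := \sum_j A i j (z j b *: e0).
have rowE i : \sum_j tens (A i j e0) (x j) = \sum_(b < m) tens (a i b) (u b).
  under eq_bigr do rewrite xz linear_sumr.
  rewrite exchange_big; apply: eq_bigr => b _; rewrite linear_sumlz.
  apply: eq_bigr => j _; have [_ _ _ ->] := bounded_op_linear (bA i j).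
  by rewrite linearZr_LR linearZl_LR.
under eq_bigr do rewrite rowE.
have -> : \sum_i rnorm (\sum_(b < m) tens (a i b) (u b)) ^+ 2 =
    \sum_i \sum_(b < m) rnorm (a i b) ^+ 2.
  apply: eq_bigr => i _.
  rewrite (@pythagoras_sum _ _ _ (index_enum 'I_m) (fun b => tens (a i b) (u b))).
  - apply: eq_bigr => b _; rewrite (rnorm_tens htens) exprMn.
    have -> : rnorm (u b) ^+ 2 = 1; last by rewrite mulr1.
    by apply: complexI; rewrite -hdotxx uo ?eqxx.
  - exact: index_enum_uniq.
  - by move=> b c bc; rewrite htens.1 uo // val_eqE (negbTE bc) mulr0.
rewrite exchange_big; apply: ler_sum => b _.
exact: (mx_contraction (fun j => z j b *: e0) bA A1).
Qed.

Lemma mxopnorm_tensor_calculus k (A : 'I_k -> 'I_k -> F -> F) :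
  (forall i j, bounded_op (A i j)) -> mxopnorm A <= 1 ->
  mxopnorm (fun i j => tensor_calculus (A i j)) <= C.
Proof.
move=> bA A1; apply: ge_sup.
  exists (vecnorm (fun i => \sum_j tensor_calculus (A i j) 0)); exists (fun=> 0) => //=.
  rewrite -ler_sqr ?nnegrE ?vecnorm_ge0 // vecnorm_sq big1 ?expr1n // => i _.
  by rewrite rnorm0 expr0n.
move=> _ [x /= x1 <-]; rewrite -ler_sqr ?nnegrE ?vecnorm_ge0 // vecnorm_sq.
have [Y0 YD _ _] := bounded_op_linear bY.
apply: (@le_trans _ _ (C ^+ 2 * \sum_i rnorm (\sum_j tens (A i j e0) (x j)) ^+ 2)).
  rewrite mulr_sumr; apply: ler_sum => i _.
  rewrite -(big_morph Y YD Y0) -exprMn ler_sqr ?nnegrE ?mulr_ge0 ?rnorm_ge0 //.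
apply: ler_piMr; first exact: sqr_ge0.
rewrite (le_trans (tensor_row_bound _ bA A1)) // -vecnorm_sq.
by rewrite expr_le1 ?vecnorm_ge0.
Qed.

Lemma cb_norm_tensor_calculus (S : set (F -> F)) : S `<=` [set A | bounded_op A] ->
  (cb_norm S tensor_calculus <= C%:E)%E.
Proof.
move=> Sb; apply: ge_ereal_sup => _ [k [A [SA A1 ->]]].
by rewrite lee_fin mxopnorm_tensor_calculus // => i j; exact: Sb.
Qed.

Lemma tensor_calculus_lin (a : R[i]) (A B : F -> F) :
  tensor_calculus (a *: A + B) = a *: tensor_calculus A + tensor_calculus B.
Proof.
have [_ YD _ YZ] := bounded_op_linear bY.
apply/funext => h; rewrite -[RHS]/(a *: Y (tens (A e0) h) + Y (tens (B e0) h)).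
by rewrite -YZ -YD -linearPl.
Qed.

Lemma bounded_op_tensor_calculus (A : F -> F) : bounded_op (tensor_calculus A).
Proof. exact: (bounded_op_comp bY (bounded_op_tensr htens _)). Qed.

Lemma opnorm_tensor_calculus (A B : F -> F) : bounded_op A -> bounded_op B ->
  opnorm (tensor_calculus A - tensor_calculus B) <= C * opnorm (A - B).
Proof.
move=> bA bB; have bAB := bounded_opB bA bB.
have [_ _ YB _] := bounded_op_linear bY.
apply: opnorm_le => [|h]; first by rewrite mulr_ge0 ?opnorm_ge0.
rewrite -[(_ - _) h]/(Y (tens (A e0) h) - Y (tens (B e0) h)) -YB -linearBl.
rewrite (le_trans (YC _)) // -mulrA ler_wpM2l // (rnorm_tens htens) ler_wpM2r ?rnorm_ge0 //.
by rewrite (le_trans (opnormP e0 bAB)) // e01 mulr1.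
Qed.

End CompletelyBounded.

(** * Shifts with length-dependent weights *)

Section LadderWeights.
Variables (R : realType) (t : nat -> R).
Hypotheses (t_ge0 : forall k, 0 <= t k) (t0 : t 0%N = 1)
  (t_add : forall j k, t (j + k)%N <= t j * t k).

Definition ladder_weight (k : nat) : R := k.+1%:R * t k / (k%:R * t k.-1).

(** The factor collected when a word of length [k] is prepended, letter by letter, to a word of
    length [j]. *)
Definition ladder_prod (k j : nat) : R := \prod_(i < k) ladder_weight (i + j).+1.

Lemma ladder_weight_ge0 k : 0 <= ladder_weight k.
Proof. by rewrite divr_ge0 ?mulr_ge0. Qed.

Lemma ladder_prod_ge0 k j : 0 <= ladder_prod k j.
Proof. by apply: prodr_ge0 => i _; exact: ladder_weight_ge0. Qed.

Lemma t_mono0 j k : t j = 0 -> t (j + k)%N = 0.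
Proof.
move=> tj; apply/eqP; rewrite eq_le t_ge0 andbT.
by rewrite (le_trans (t_add _ _)) // tj mul0r.
Qed.

(** The form without division survives [t k = 0], because [t] vanishes from its first zero
    onwards. *)
Lemma ladder_weightE k : ladder_weight k.+1 * (k.+1%:R * t k) = k.+2%:R * t k.+1.
Proof.
have [tk|tk] := eqVneq (t k) 0.
  by rewrite tk -[X in _ = _ * t X]addn1 (t_mono0 1 tk) !mulr0.
by rewrite /ladder_weight /= divfK // mulf_neq0 // pnatr_eq0.
Qed.

Lemma ladder_prodS k j : ladder_prod k.+1 j = ladder_prod k j * ladder_weight (k + j).+1.
Proof. by rewrite /ladder_prod big_ord_recr. Qed.

Lemma ladder_prodE k j : ladder_prod k j * (j.+1%:R * t j) = (k + j).+1%:R * t (k + j)%N.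
Proof.
elim: k => [|k IHk]; first by rewrite /ladder_prod big_ord0 mul1r.
by rewrite ladder_prodS mulrAC IHk mulrC ladder_weightE.
Qed.

Lemma ladder_prod0 k : ladder_prod k 0 = k.+1%:R * t k.
Proof. by have := ladder_prodE k 0; rewrite t0 !mulr1 addn0. Qed.

Lemma ladder_prod_le k j : ladder_prod k j <= k.+1%:R * t k.
Proof.
have [tj|tj] := eqVneq (t j) 0.
  (* When [t j = 0] a nonempty product has its first denominator equal to 0, hence is 0; the empty
     product is 1. *)
  case: k => [|k]; first by rewrite /ladder_prod big_ord0 t0 mulr1.
  rewrite /ladder_prod big_ord_recl /= /ladder_weight add0n /= tj mulr0 invr0 mulr0 mul0r.
  by rewrite mulr_ge0.
have tj0 : 0 < t j by rewrite lt_neqAle eq_sym tj t_ge0.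
rewrite -(@ler_pM2r _ (j.+1%:R * t j)) ?mulr_gt0 // ladder_prodE.
apply: (@le_trans _ _ ((k + j).+1%:R * (t k * t j))); first by rewrite ler_wpM2l.
(* What remains is [k + j + 1 <= (k + 1) (j + 1)]. *)
rewrite mulrACA ler_wpM2r ?mulr_ge0 // -natrM ler_nat.
by nia.
Qed.

Lemma ladder_weight_le k : ladder_weight k.+1 <= 2 * t 1%N.
Proof.
have := ladder_prod_le 1 k.
by rewrite /ladder_prod big_ord1.
Qed.

End LadderWeights.

Section WeightedShift.
Variables (R : realType) (n : nat) (F : hilbertType R) (e : seq 'I_n -> F).
Hypothesis he : orthonormal_basis e.
Variable t : nat -> R.
Hypotheses (t_ge0 : forall k, 0 <= t k) (t0 : t 0%N = 1)
  (t_add : forall j k, t (j + k)%N <= t j * t k).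

Lemma basis_map (f : seq 'I_n -> seq 'I_n) (d : seq 'I_n -> R) (C : R) :
  injective f -> (forall w, 0 <= d w) -> (forall w, d w <= C) ->
  exists B : F -> F, [/\ bounded_op B, forall x, rnorm (B x) <= C * rnorm x &
    forall w, B (e w) = (d w)%:C *: e (f w)].
Proof.
move=> fI d0 dC; have C0 : 0 <= C by rewrite (le_trans (d0 [::])).
have [|B [bB BC BJ]] := weighted_map (basis_line_linear e) (rnorm_basis_line he)
  (basis_line_orth he) (basis_line_dense he) (d := fun w => (d w)%:C) fI C0.
  by move=> w; rewrite cnorm_real ger0_norm.
exists B; split=> // w; have := BJ w (1 : R[i]).
by rewrite /basis_line !scale1r.
Qed.

Lemma ladder_shift_exists : exists W : 'I_n -> F -> F, forall i,
  bounded_op (W i) /\ forall w, W i (e w) = (ladder_weight t (size w).+1)%:C *: e (i :: w).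
Proof.
have /choice [W WP] : forall i, exists B : F -> F, bounded_op B /\
    forall w, B (e w) = (ladder_weight t (size w).+1)%:C *: e (i :: w).
  move=> i; have [|||B [bB _ BE]] := @basis_map (cons i)
    (fun w => ladder_weight t (size w).+1) (2 * t 1%N).
  - by move=> v w [].
  - by move=> w; exact: ladder_weight_ge0.
  - by move=> w; exact: ladder_weight_le.
  by exists B.
by exists W.
Qed.

Lemma basis_hdot_inj (x y : F) : (forall w, hdot x (e w) = hdot y (e w)) -> x = y.
Proof.
move=> xy; pose r (x : F) (y : F) : R[i]^o := Num.conj (hdot x y).
have rb z : bounded_op (r z : F -> R[i]^o).
  apply: (bounded_op_intro (C := rnorm z)) => [a u v|u].
    by rewrite /r hdotDr hdotZr rmorphD rmorphM /= conjCK.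
  by rewrite cnorm_conj cauchy_schwarz.
have rxy : r x = r y by apply: (basis_eq he (rb x) (rb y)) => w; rewrite /r xy.
by apply: hdot_inj => z; apply: (can_inj (@conjCK _)); rewrite -/(r x z) rxy.
Qed.

Variable W : 'I_n -> F -> F.
Hypotheses (bW : forall i, bounded_op (W i))
  (We : forall i w, W i (e w) = (ladder_weight t (size w).+1)%:C *: e (i :: w)).

Lemma opword_shift w u :
  opword W w (e u) = (ladder_prod t (size w) (size u))%:C *: e (w ++ u).
Proof.
elim: w => [|i w IHw] /=; first by rewrite /ladder_prod big_ord0 scale1r.
have [_ _ _ WZ] := bounded_op_linear (bW i).
by rewrite IHw WZ We scalerA -rmorphM size_cat ladder_prodS.
Qed.

Lemma hdot_adjoint_shift w v u : hdot (adjoint (opword W w) (e v)) (e u) =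
  (ladder_prod t (size w) (size u))%:C * (w ++ u == v)%:R.
Proof.
rewrite hdotC -(adjointP (bounded_op_word bW w)).2 opword_shift hdotZl he.1.
by rewrite rmorphM rmorph_nat /= -[Num.conj _]/(conjc _) conjc_real.
Qed.

(** The operator is diagonal: among the words of length [k] only the prefix of [v] has an adjoint
    that does not kill [e v], and applying the word again restores [v]. *)
Lemma rowsum_shift k v : rowsum W k (e v) =
  (if (k <= size v)%N then (ladder_prod t k (size v - k)) ^+ 2 else 0)%:C *: e v.
Proof.
rewrite /rowsum sum_funE; case: leqP => [kv|vk]; last first.
  rewrite scale0r big1 // => w _ /=.
  have -> : adjoint (opword W w) (e v) = 0.
    apply: basis_hdot_inj => u; rewrite hdot_adjoint_shift hdot0l.
    case: eqP => [wuv|_]; last by rewrite mulr0.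
    by move: vk; rewrite -wuv size_cat size_tuple ltnNge leq_addr.
  by have [-> _ _ _] := bounded_op_linear (bounded_op_word bW w).
have adjE (w : k.-tuple 'I_n) : adjoint (opword W w) (e v) =
    ((val w == take k v)%:R * ladder_prod t k (size v - k))%:C *: e (drop k v).
  apply: basis_hdot_inj => u; rewrite hdot_adjoint_shift hdotZl he.1 size_tuple.
  have -> : (val w ++ u == v) = (val w == take k v) && (drop k v == u).
    rewrite -{1}(cat_take_drop k v) eqseq_cat 1?[drop k v == u]eq_sym //.
    by rewrite size_tuple size_takel.
  case: eqP => [_|_] /=; last by rewrite mul0r mul0r mulr0.
  by case: eqP => [<-|_]; rewrite ?mulr0 // mul1r size_drop.
have tk : size (take k v) == k by rewrite size_takel.
rewrite (bigD1 (Tuple tk)) //= big1 => [|w wt].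
  have [_ _ _ WZ] := bounded_op_linear (bounded_op_word bW (take k v)).
  have := adjE (Tuple tk); rewrite /= => ->.
  rewrite eqxx mul1r WZ opword_shift cat_take_drop scalerA -rmorphM addr0.
  by rewrite size_drop size_takel // expr2.
rewrite adjE; have [_ _ _ ->] := bounded_op_linear (bounded_op_word bW w).
by rewrite -(inj_eq val_inj) /= in wt; rewrite (negbTE wt) mul0r scale0r.
Qed.

Lemma opnorm_rowsum_shift k : (0 < n)%N -> opnorm (rowsum W k) = (k.+1%:R * t k) ^+ 2.
Proof.
move=> n0; have tk0 : 0 <= k.+1%:R * t k by rewrite mulr_ge0.
have bR := bounded_op_rowsum bW k.
apply/eqP; rewrite eq_le; apply/andP; split.
  apply: opnorm_le; first exact: sqr_ge0.
  have [_ _ _ RZ] := bounded_op_linear bR.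
  apply: (diagonal_bound (basis_line_linear e) (rnorm_basis_line he)
    (basis_line_orth he) (basis_line_dense he)
    (d := fun v => (if (k <= size v)%N then (ladder_prod t k (size v - k)) ^+ 2 else 0)%:C))
      => //; first exact: sqr_ge0.
    by move=> w v; rewrite /basis_line RZ rowsum_shift !scalerA mulrC.
  move=> w; case: ifP => _; rewrite cnorm_real ?normr0 ?sqr_ge0 //.
  by rewrite ger0_norm ?sqr_ge0 // ler_sqr ?nnegrE ?ladder_prod_ge0 // ladder_prod_le.
(* At a word of length [k] the adjoint reaches the vacuum, where the bound on [ladder_prod] is an
   equality. Such a word exists because [n > 0]. *)
pose v := nseq k (Ordinal n0).
have := opnormP (e v) bR; rewrite rowsum_shift size_nseq leqnn subnn ladder_prod0 //.
by rewrite rnormZ cnorm_real (rnorm_basis he) !mulr1 ger0_norm ?sqr_ge0.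
Qed.

End WeightedShift.

(** * Resolvents in closed subalgebras *)

Section ClosedSubalgebras.
Variables (R : realType) (U : normedModType R[i]).
Implicit Types A B M : U -> U.

Lemma opnorm_comp_le A B : bounded_op A -> bounded_op B ->
  opnorm (A \o B) <= opnorm A * opnorm B.
Proof.
move=> bA bB; apply: opnorm_le => [|x]; first by rewrite mulr_ge0 ?opnorm_ge0.
by rewrite (le_trans (opnormP _ bA)) // -mulrA ler_wpM2l ?opnorm_ge0 // opnormP.
Qed.

Lemma opnormZ_le (a : R[i]) A : bounded_op A -> opnorm (a *: A) <= rnorm a * opnorm A.
Proof.
move=> bA; apply: opnorm_le => [|x]; first by rewrite mulr_ge0 ?opnorm_ge0 ?cnorm_ge0.
by rewrite -[(a *: A) x]/(a *: A x) rnormZ -mulrA ler_wpM2l ?cnorm_ge0 // opnormP.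
Qed.

Lemma opnormD_le A B : bounded_op A -> bounded_op B -> opnorm (A + B) <= opnorm A + opnorm B.
Proof.
move=> bA bB; apply: opnorm_le => [|x]; first by rewrite addr_ge0 ?opnorm_ge0.
by rewrite -[(A + B) x]/(A x + B x) (le_trans (rnormD _ _)) // mulrDl lerD ?opnormP.
Qed.

Definition resolvent A (a : R[i]) B := [/\ bounded_op B,
  forall x, B (a *: x - A x) = x & forall x, a *: B x - A (B x) = x].

Lemma spectrumP A a : ~ spectrum A a <-> exists B, resolvent A a B.
Proof.
split=> [/contrapT [B [bB B1 B2]]|[B [bB B1 B2]]].
  by exists B; split=> // x; [have := congr1 (@^~ x) B1|have := congr1 (@^~ x) B2].
by apply; exists B; split=> //; apply/funext => x; [exact: B1|exact: B2].
Qed.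

Variable S : set (U -> U).
Hypotheses (hS : closed_subalgebra S) (S1 : S id).

Let S_bounded A : S A -> bounded_op A.
Proof. by case: hS => Sb _ _ _; exact: Sb. Qed.

Let S_lin (a : R[i]) A B : S A -> S B -> S (a *: A + B).
Proof. by case: hS => _ SL _ _; exact: SL. Qed.

Let S_comp A B : S A -> S B -> S (A \o B).
Proof. by case: hS => _ _ SM _; exact: SM. Qed.

Let S0 : S 0.
Proof. by rewrite -(addNr (id : U -> U)) -scaleN1r; exact: S_lin. Qed.

Let SZ (a : R[i]) A : S A -> S (a *: A).
Proof. by move=> SA; rewrite -[_ *: _]addr0; exact: S_lin. Qed.

(** Since [B], a right inverse of [1 - M], is already given, no series has to be summed: the partial
    sums [u k] lie in [S] and [B - u k = M^k B] tends to 0. *)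
Lemma neumann_mem M B : S M -> opnorm M < 1 -> bounded_op B ->
  (forall x, B x = x + M (B x)) -> S B.
Proof.
move=> SM M1 bB BE; have bM := S_bounded SM.
pose u := fix u k : U -> U := if k is k'.+1 then M \o u k' + id else 0.
have Su k : S (u k).
  elim: k => [|k IHk]; first exact: S0.
  by rewrite /= -[M \o _]scale1r; apply: S_lin => //; exact: S_comp.
have M0 := opnorm_ge0 bM; have B0 := opnorm_ge0 bB.
have uB k : opnorm (B - u k) <= opnorm M ^+ k * opnorm B.
  elim: k => [|k IHk]; first by rewrite subr0 mul1r.
  have -> : B - u k.+1 = M \o (B - u k).
    apply/funext => x; have [_ _ MB _] := bounded_op_linear bM.
    rewrite -[LHS]/(B x - (M (u k x) + x)) -[RHS]/(M (B x - u k x)) MB {1}BE opprD.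
    by rewrite [- _ - x]addrC addrACA subrr add0r.
  have bu := bounded_opB bB (S_bounded (Su k)).
  by rewrite (le_trans (opnorm_comp_le bM bu)) // exprS -mulrA ler_wpM2l.
case: hS => _ _ _; apply=> // eps eps0.
have e1 : 0 < eps / (opnorm B + 1) by rewrite divr_gt0 // ltr_wpDl.
have /cvgrPdist_lt /(_ _ e1) [N _ /(_ N (leqnn _))] : opnorm M ^+ k @[k --> \oo] --> (0 : R).
  by apply: cvg_expr; rewrite ger0_norm.
rewrite /= sub0r normrN ger0_norm ?exprn_ge0 // => MN.
exists (u N) => //; rewrite (le_lt_trans (uB N)) //.
move: MN; rewrite ltr_pdivlMr ?ltr_wpDl //; apply: le_lt_trans.
by rewrite ler_wpM2l ?exprn_ge0 // lerDl.
Qed.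

(** With [N = B' (a - A)], the inverse of [1 - (a - a') B], one has [B' = N B]; the Neumann argument
    puts [N] in [S]. *)
Lemma resolvent_step A a a' B B' : bounded_op A -> resolvent A a B -> resolvent A a' B' ->
  S B -> rnorm (a' - a) * opnorm B < 1 -> S B'.
Proof.
move=> bA [bB B1 B2] [bB' B1' B2'] SB aB.
have [_ AD AB AZ] := bounded_op_linear bA.
have [_ BD BB BZ] := bounded_op_linear bB.
have [_ BD' BB' BZ'] := bounded_op_linear bB'.
pose M := (a - a') *: B; have SM : S M by exact: SZ.
have ME x : M x = (a - a') *: B x by [].
pose N x := B' (a *: x - A x).
have bN : bounded_op N.
  have -> : N = B' \o (a *: id - A) by [].
  by apply: bounded_op_comp => //; apply/bounded_opB => //; exact/bounded_opZ/bounded_op_id.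
have SN : S N.
  apply: (neumann_mem SM) => // [|x].
    by apply: le_lt_trans aB; rewrite -cnormN opprB; exact: opnormZ_le.
  rewrite ME -BZ; apply/eqP; rewrite -subr_eq -{1}(B1 (N x)) -BB; apply/eqP.
  have <- : a *: x - A x = a *: N x - A (N x) - (a - a') *: N x; last exact: B1.
  by rewrite -(B2' (a *: x - A x)) scalerBl opprB [RHS]addrC addrA subrK.
have -> : B' = N \o B by apply/funext => x; rewrite /N /= B2.
exact: S_comp.
Qed.

(** Here [a B] is the inverse of [1 - a^-1 A], and [a^-1 A] has norm less than 1. *)
Lemma resolvent_large A a B : S A -> resolvent A a B -> opnorm A < rnorm a -> S B.
Proof.
move=> SA [bB B1 B2] Aa; have bA := S_bounded SA.
have a0 : 0 < rnorm a by rewrite (le_lt_trans (opnorm_ge0 bA)).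
have an0 : a != 0 by apply: contraTneq a0 => ->; rewrite cnorm0 ltxx.
have [_ AD AB AZ] := bounded_op_linear bA.
have SN : S (a *: B).
  apply: (neumann_mem (SZ a^-1 SA)) => [||x]; last 1 first.
  - rewrite -[(a *: B) x]/(a *: B x) -[RHS]/(x + a^-1 *: A (a *: B x)).
    by rewrite AZ scalerA mulVf // scale1r -{2}(B2 x) subrK.
  - by rewrite (le_lt_trans (opnormZ_le _ bA)) // cnormV ltr_pdivrMl ?mulr1.
  - exact: bounded_opZ.
by have := SZ a^-1 SN; rewrite scalerA mulVf // scale1r.
Qed.

(* The parameters t >= 1 for which the resolvent at t * a lies in S form an open and
   closed subset of the half-line, which contains all large t. *)
Lemma resolvent_mem A a (rho : R) B : S A -> 0 <= rho ->
  (forall b, rho < rnorm b -> exists B, resolvent A b B) ->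
  rho < rnorm a -> resolvent A a B -> S B.
Proof.
move=> SA rho0 hres rhoa hB; have bA := S_bounded SA.
have a0 : 0 < rnorm a by rewrite (le_lt_trans rho0).
have /choice [Q QP] : forall t : R, exists B, 1 <= t -> resolvent A (t%:C * a) B.
  move=> t; have [t1|] := boolP (1 <= t); last by exists 0.
  have [|B' hB'] := hres (t%:C * a); last by exists B'.
  rewrite cnormM cnorm_real ger0_norm ?(le_trans ler01) // (lt_le_trans rhoa) //.
  by rewrite ler_peMl // ltW.
suff SQ : S (Q 1).
  have -> // : B = Q 1.
  have := QP 1 (lexx _); rewrite rmorph1 mul1r => -[_ Q1 Q2].
  by case: hB => _ B1 B2; apply/funext => x; rewrite -[x in LHS]Q2 B1.
have step s s' : 1 <= s -> 1 <= s' -> S (Q s) ->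
    `|s' - s| * rnorm a * opnorm (Q s) < 1 -> S (Q s').
  move=> s1 s1' Ss h; apply: (resolvent_step bA (QP _ s1) (QP _ s1') Ss).
  by rewrite -mulrBl -rmorphB cnormM cnorm_real.
(* With [c] the norm of [Q t], the radius [1 / (4 (c + 1) |a|)] and the resolvent identity bound the
   norm of [Q s] by [4 c / 3]. Then [|s' - s| |a|] times that norm is at most [2 / 3], so a single
   [step] leads from [s] to [s']. The symmetry in [s] and [s'] covers openness and closedness
   together. *)
have local t : 1 <= t -> exists2 d : R, 0 < d & forall s s', 1 <= s -> 1 <= s' ->
    `|s - t| < d -> `|s' - t| < d -> S (Q s) -> S (Q s').
  move=> t1; have [bQ Q1 Q2] := QP t t1; have c0 := opnorm_ge0 bQ.
  set c := opnorm (Q t) in c0; have c1 : 0 < 4 * (c + 1) * rnorm a.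
    by rewrite !mulr_gt0 // ltr_wpDl.
  exists (4 * (c + 1) * rnorm a)^-1; first by rewrite invr_gt0.
  move=> s s' s1 s1'; rewrite -[_^-1]mul1r !ltr_pdivlMr // => st st' Ss.
  apply: (step s) => //; have [bs Qs1 Qs2] := QP s s1.
  have qs0 := opnorm_ge0 bs; set q := opnorm (Q s) in qs0 *.
  have QE : Q s = Q t - ((s - t)%:C * a) *: (Q t \o Q s).
    apply/funext => x.
    have [_ QD QB QZ] := bounded_op_linear bQ.
    rewrite -[RHS]/(Q t x - ((s - t)%:C * a) *: Q t (Q s x)) -QZ -QB.
    rewrite -{2}(Qs2 x) -[LHS]Q1; congr (Q t _).
    by rewrite addrAC -scalerBl -mulrBl rmorphB /= subKr.
  have qle : q <= c + `|s - t| * rnorm a * (c * q).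
    have bc := bounded_op_comp bQ bs.
    rewrite /q {1}QE -scaleNr (le_trans (opnormD_le bQ (bounded_opZ _ bc))) // lerD2l.
    rewrite (le_trans (opnormZ_le _ bc)) // cnormN cnormM cnorm_real.
    by rewrite ler_wpM2l ?mulr_ge0 ?cnorm_ge0 // opnorm_comp_le.
  have tri : `|s' - s| <= `|s - t| + `|s' - t|.
    by rewrite [leRHS]addrC (distrC s t) ler_distD.
  move: st st' qle tri (normr_ge0 (s - t)) (normr_ge0 (s' - t)).
  move: (`|s - t|) (`|s' - t|) (`|s' - s|).
  move: (rnorm a) a0 => r r0 x y z hx hy hq hz x0 y0.
  have xr : x * r * (c + 1) < 4^-1 by move: hx; lra.
  have yr : y * r * (c + 1) < 4^-1 by move: hy; lra.
  have xr0 : 0 <= x * r by rewrite mulr_ge0 // ltW.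
  have yr0 : 0 <= y * r by rewrite mulr_ge0 // ltW.
  have xrc : x * r * c <= 4^-1 by move: xr xr0; lra.
  have yrc : y * r * c <= 4^-1 by move: yr yr0; lra.
  have q43 : q <= 4 / 3 * c.
    have : x * r * c * q <= 4^-1 * q by rewrite ler_wpM2r.
    by move: hq; lra.
  have zr : z * r <= (x + y) * r by rewrite ler_wpM2r // ltW.
  have zrq : z * r * q <= (x + y) * r * (4 / 3 * c).
    apply: (@le_trans _ _ ((x + y) * r * q)); first by rewrite ler_wpM2r.
    by rewrite ler_wpM2l // mulr_ge0 ?addr_ge0 // ltW.
  by apply: le_lt_trans zrq _; move: xrc yrc; lra.
pose E : set R := [set t | 1 <= t /\ forall s, t <= s -> S (Q s)].
have E0 : E !=set0.
  exists (1 + opnorm A / rnorm a); have A0 := opnorm_ge0 bA.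
  split=> [|s ts]; first by rewrite lerDl divr_ge0 // ltW.
  have s1 : 1 <= s by rewrite (le_trans _ ts) // lerDl divr_ge0 // ltW.
  apply: (resolvent_large SA (QP s s1)).
  rewrite cnormM cnorm_real ger0_norm ?(le_trans ler01) // -ltr_pdivrMr //.
  by rewrite (lt_le_trans _ ts) // ltrDr.
have infE : has_inf E by split=> //; exists 1 => t [].
pose t0 := inf E; have t01 : 1 <= t0 by apply: lb_le_inf => // t [].
have [d d0 hd] := local t0 t01.
have [t [t1 tS] td] := inf_adherent d0 infE.
have t0t : t0 <= t by apply: ge_inf; [exact: infE.2|split].
(* Some point of [E] lies within [d] of the infimum, and membership spreads from it to the whole
   interval around [t0]. If that interval stayed above 1, the infimum could be lowered. *)
have near s : 1 <= s -> t0 - d < s -> S (Q s).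
  move=> s1 sd; have [st|ts] := ltP s t; last exact: tS.
  apply: (hd t s t1 s1); last exact: tS.
  - by rewrite ger0_norm ?subr_ge0 // ltrBlDl.
  - by rewrite ltr_distl sd /= (lt_trans st).
have [h|h] := ltP (t0 - d) 1; first exact: near.
have : E (t0 - d / 2).
  split=> [|s hs]; first by move: h d0; lra.
  by apply: near; move: hs h d0; lra.
by move=> /(ge_inf infE.2); rewrite -/t0; move: d0; lra.
Qed.

End ClosedSubalgebras.

(** * Spectral radius and existence of resolvents *)

Section HilbertSpectrum.
Variables (R : realType) (U : hilbertType R) (A : U -> U).
Hypothesis bA : bounded_op A.

(** The operator [D = a - A] is bounded below by [|a| - opnorm A]. Its range is dense, since [z]
    orthogonal to it gives [|a| |z|^2 = |<z, A z>|], forcing [z = 0]. The inverse is the bounded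
    extension of the inverse graph. *)
Lemma resolvent_exists a : opnorm A < rnorm a -> exists B, resolvent A a B.
Proof.
move=> Aa; pose D x := a *: x - A x; pose d := rnorm a - opnorm A.
have d0 : 0 < d by rewrite subr_gt0.
have bD : bounded_op D.
  have -> : D = a *: id - A by [].
  by apply/bounded_opB => //; exact/bounded_opZ/bounded_op_id.
have [D0 DD DB DZ] := bounded_op_linear bD.
have Dle x : d * rnorm x <= rnorm (D x).
  have -> : rnorm (D x) = rnorm (D x) + rnorm (A x) - rnorm (A x) by rewrite addrK.
  have := rnormD (D x) (A x); rewrite subrK rnormZ.
  by have := opnormP x bA; rewrite /d mulrBl; lra.
have Dd : closure (range D) = setT.
  rewrite -subTset => x _.
  have [|||y Sy hy] := @projection_theorem R U (closure (range D)) x.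
  - by apply: subset_closure; exists 0.
  - apply: closure_lin => b _ _ [u _ <-] [v _ <-]; exists (b *: u + v) => //.
    by rewrite DD DZ.
  - exact: closed_closure.
  have -> // : x = y; apply/eqP; rewrite -subr_eq0; apply/eqP; set z := x - y.
  have /hy : closure (range D) (D z) by apply: subset_closure; exists z.
  rewrite -/z hdotBr hdotZr hdotxx => /subr0_eq /(congr1 (@rnorm R R[i])).
  rewrite cnormM cnorm_conj cnorm_real ger0_norm ?sqr_ge0 // => h.
  have := cauchy_schwarz z (A z); rewrite -h => h'.
  have := ler_wpM2l (rnorm_ge0 z) (opnormP z bA) => h''.
  apply: rnorm_eq0; apply/eqP; rewrite -sqrf_eq0 eq_le sqr_ge0 andbT.
  by rewrite -(ler_pM2l d0) mulr0 /d mulrBl subr_le0; move: h' h''; lra.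
pose G : set (U * U) := [set p | p.1 = D p.2].
have [||||B [bB BC BG]] := @bounded_extension R U U G d^-1.
- by rewrite invr_ge0 ltW.
- by move=> b p q; rewrite /G /= => -> ->; rewrite DD DZ.
- by move=> p; rewrite /G /= => ->; rewrite ler_pdivlMl.
- rewrite -Dd; congr closure; apply/seteqP; split=> [_ [p Gp <-]|_ [x _ <-]].
    by rewrite Gp; exists p.2.
  by exists (D x, x).
have BD x : B (D x) = x by exact: (BG (D x, x)).
exists B; split=> // x; apply/eqP; rewrite -subr_eq0; apply/eqP/rnorm_eq0/eqP.
have bDB := bounded_opB (bounded_op_comp bD bB) (bounded_op_id U).
rewrite eq_le rnorm_ge0 andbT -[leRHS](mul0r (rnorm x)).
apply: (dense_bound bDB Dd) => // _ [y _ <-].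
rewrite -[(D \o B - id) _]/(D (B (D y)) - D y) BD subrr rnorm0 mul0r //.
Qed.

Lemma has_ubound_spectrum : has_ubound [set rnorm a | a in spectrum A].
Proof.
exists (opnorm A) => _ [a sa <-]; rewrite leNgt; apply/negP => /resolvent_exists.
by move=> /spectrumP.
Qed.

Lemma spectral_radius_ge0 : 0 <= spectral_radius A.
Proof.
rewrite /spectral_radius.
have [->|/set0P [r [a sa ar]]] := eqVneq [set rnorm a | a in spectrum A] set0.
  by rewrite sup0.
apply: (@le_trans _ _ r); first by rewrite -ar cnorm_ge0.
by apply: (ub_le_sup has_ubound_spectrum); exists a.
Qed.

Lemma resolvent_above_spectral_radius a :
  spectral_radius A < rnorm a -> exists B, resolvent A a B.
Proof.
move=> ra; apply/spectrumP => sa; move: ra; apply/negP; rewrite -leNgt.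
by apply: (ub_le_sup has_ubound_spectrum); exists a.
Qed.

End HilbertSpectrum.

Lemma spectral_radius_le (R : realType) (U : normedModType R[i]) (A : U -> U) (rho : R) :
  0 <= rho -> (forall a, rho < rnorm a -> exists B, resolvent A a B) ->
  spectral_radius A <= rho.
Proof.
move=> rho0 hres; rewrite /spectral_radius.
have [->|/set0P ne] := eqVneq [set rnorm a | a in spectrum A] set0; first by rewrite sup0.
apply: ge_sup => // _ [a sa <-]; rewrite leNgt; apply/negP => /hres.
by move=> /spectrumP.
Qed.

(** * An elementary bound for the sum of inverse squares *)

Section InverseSquares.
Variable R : realType.
Implicit Types x y : R.

Lemma sin_le_id x : 0 <= x -> sin x <= x.
Proof.
move=> x0; have [|c _] := @MVT_segment R sin cos 0 x x0.
  by apply: continuous_subspaceT => y; exact: continuous_sin.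
rewrite sin0 !subr0 => ->; rewrite ler_piMl // cos_le1 //.
Qed.

(** The shift by [pi / 2] turns the sine into a cosine, and
    [1 / sin^2 + 1 / cos^2 = 1 / (sin cos)^2]. *)
Lemma inv_sin_sq_half x : sin (x *+ 2) != 0 ->
  4 / sin (x *+ 2) ^+ 2 = (sin x ^+ 2)^-1 + (sin (x + pi / 2) ^+ 2)^-1.
Proof.
rewrite sinDpihalf sin_mulr2n mulrn_eq0 /= mulf_eq0 negb_or => /andP [c0 s0].
have h := cos2Dsin2 x.
transitivity ((cos x ^+ 2 + sin x ^+ 2) / (cos x * sin x) ^+ 2).
  by rewrite h; field; rewrite c0 s0.
by field; rewrite c0 s0.
Qed.

Lemma big_even_odd m (f : nat -> R) :
  \sum_(k < m.*2) f k = \sum_(k < m) f k.*2 + \sum_(k < m) f k.*2.+1.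
Proof.
elim: m => [|m IHm]; first by rewrite !big_ord0 addr0.
by rewrite doubleS !big_ord_recr /= IHm; ring.
Qed.

Lemma sum_inv_sin_sq n x : sin x != 0 ->
  \sum_(k < 2 ^ n) (sin ((x + k%:R * pi) / 2 ^+ n) ^+ 2)^-1 = 4 ^+ n / sin x ^+ 2.
Proof.
elim: n x => [|n IHn] x sx.
  by rewrite expn0 big_ord1 mul0r addr0 !expr0 divr1 mul1r.
have x2 : x = (x / 2) *+ 2 by rewrite -mulr_natr divfK.
have sx2 : sin ((x / 2) *+ 2) != 0 by rewrite -x2.
have := sx2; rewrite sin_mulr2n mulrn_eq0 /= mulf_eq0 negb_or => /andP [c0 s0].
rewrite [4 ^+ n.+1]exprSr -mulrA {2}x2 inv_sin_sq_half // mulrDr.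
rewrite -IHn // -IHn ?sinDpihalf // expnS mul2n.
(* Even indices come from the sum at [x / 2], odd ones from the sum at [x / 2 + pi / 2]. *)
rewrite (big_even_odd _ (fun k : nat => (sin ((x + k%:R * pi) / 2 ^+ n.+1) ^+ 2)^-1)).
have two0 : (2 : R) != 0 by [].
by congr (_ + _); apply: eq_bigr => k _; congr ((sin _ ^+ 2)^-1);
   rewrite exprS -?addn1 ?natrD -muln2 natrM; field.
Qed.

(** The sine identity at [pi / 2] has nodes [y k = (2 k + 1) pi / (4 M)], symmetric about [pi / 2],
    so half of them contribute [2 M^2]. Since [sin y <= y], the sum of [1 / (y k)^2] over this half
    is at most [2 M^2]; [M] cancels and no limit is taken. *)
Lemma sum_inv_odd_sq_le m : \sum_(k < m) ((k.*2.+1)%:R ^+ 2)^-1 <= pi ^+ 2 / 8 :> R.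
Proof.
have pi0 := pi_gt0 R.
have [n mn] : exists n, (m <= 2 ^ n)%N by exists m; exact/ltnW/ltn_expl.
apply: (@le_trans _ _ (\sum_(k < 2 ^ n) ((k.*2.+1)%:R ^+ 2)^-1)).
  rewrite -(subnKC mn) big_split_ord /= lerDl; apply: sumr_ge0 => k _.
  by rewrite invr_ge0 sqr_ge0.
pose M : R := 2 ^+ n; have M0 : 0 < M by rewrite exprn_gt0.
have ME : (2 ^ n)%:R = M by rewrite natrX.
pose y (k : nat) : R := (pi / 2 + k%:R * pi) / (2 * M).
pose g k := (sin (y k) ^+ 2)^-1.
have sum_g : \sum_(k < 2 ^ n) g k + \sum_(k < 2 ^ n) g (2 ^ n + k)%N = 4 * M ^+ 2.
  have := @sum_inv_sin_sq n.+1 (pi / 2).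
  rewrite sin_pihalf expr1n divr1 oner_neq0 => /(_ isT).
  rewrite expnS mul2n -addnn big_split_ord /= /g /y /M -exprS => ->.
  by rewrite exprS -exprM mulnC exprM; congr (_ * _ ^+ n); ring.
have rev_g : \sum_(k < 2 ^ n) g (2 ^ n + k)%N = \sum_(k < 2 ^ n) g k.
  rewrite (reindex_inj rev_ord_inj); apply: eq_bigr => k _ /=; congr ((_ ^+ 2)^-1).
  have -> : y (2 ^ n + (2 ^ n - k.+1))%N = pi - y k.
    rewrite /y natrD natrB // ME -(addn1 k) natrD; field.
    by rewrite gt_eqF.
  by rewrite sinB sinpi cospi mul0r sub0r mulN1r opprK.
have g_ge (k : 'I_(2 ^ n)) : 16 * M ^+ 2 / pi ^+ 2 * ((k.*2.+1)%:R ^+ 2)^-1 <= g k.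
  have kM : (k.+1)%:R <= M by rewrite -ME ler_nat.
  have k0 : 0 <= k%:R :> R by [].
  have y0 : 0 < y k by rewrite /y divr_gt0 ?mulr_gt0 // ltr_wpDr ?mulr_ge0 ?divr_gt0 // ltW.
  have ypi : y k < pi.
    rewrite /y ltr_pdivrMr ?mulr_gt0 //; move: kM; rewrite -natr1 => kM; nra.
  have s0 : 0 < sin (y k) by rewrite sin_gt0_pi // y0.
  have -> : 16 * M ^+ 2 / pi ^+ 2 * ((k.*2.+1)%:R ^+ 2)^-1 = (y k ^+ 2)^-1.
    have -> : y k = (k.*2.+1)%:R * pi / 2 / (2 * M).
      by rewrite /y; congr (_ / _); rewrite -[k.*2.+1]addn1 natrD -muln2 natrM; field.
    have alg (a p : R) : a != 0 -> p != 0 ->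
        16 * M ^+ 2 / p ^+ 2 * (a ^+ 2)^-1 = ((a * p / 2 / (2 * M)) ^+ 2)^-1.
      by move=> a0 p0; field; rewrite a0 p0 gt_eqF.
    by apply: alg; rewrite ?pnatr_eq0 // gt_eqF.
  rewrite lef_pV2 ?posrE ?exprn_gt0 // ler_sqr ?nnegrE ?(ltW s0) ?(ltW y0) //.
  by rewrite sin_le_id // ltW.
have := ler_sum (index_enum 'I_(2 ^ n)) (fun k (_ : true) => g_ge k).
rewrite -mulr_sumr; set O := \sum_(_ < _) _ => hO.
have : 16 * M ^+ 2 / pi ^+ 2 * O <= 2 * M ^+ 2.
  by move: hO sum_g; rewrite rev_g; lra.
rewrite mulrAC ler_pdivrMr ?exprn_gt0 // => h.
have MM : 0 < M ^+ 2 by rewrite exprn_gt0.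
rewrite -(ler_pM2l MM); move: h; lra.
Qed.

(** Splitting the first [2 N] terms by parity gives [B N <= B (2 N) = odd part + B N / 4], so three
    quarters of [B N] are at most [pi^2 / 8]. *)
Lemma sum_inv_sq_le N : \sum_(k < N) (k.+1%:R ^+ 2)^-1 <= pi ^+ 2 / 6 :> R.
Proof.
pose B m : R := \sum_(k < m) (k.+1%:R ^+ 2)^-1.
have B_mono : B N <= B N.*2.
  rewrite /B -addnn big_split_ord /= lerDl; apply: sumr_ge0 => k _.
  by rewrite invr_ge0 sqr_ge0.
have BE : B N.*2 = \sum_(k < N) ((k.*2.+1)%:R ^+ 2)^-1 + B N / 4.
  rewrite /B (big_even_odd _ (fun k : nat => (k.+1%:R ^+ 2)^-1)); congr (_ + _).
  rewrite mulr_suml; apply: eq_bigr => k _.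
  by rewrite -doubleS -muln2 natrM; field; rewrite ?pnatr_eq0.
have := sum_inv_odd_sq_le N; rewrite -/(B N); lra.
Qed.

End InverseSquares.

(** * Polynomial factors under growing roots *)

Section RootLimit.
Variable R : realType.

Lemma ln_nat_div_cvg0 : (fun k : nat => ln (k.+1%:R : R) / k%:R) @ \oo --> (0 : R).
Proof.
apply/cvgrPdist_lt => eps eps0.
(* From [ln (k + 1) = 2 ln (sqrt (k + 1)) < 2 sqrt (k + 1)] it suffices that
   [4 (k + 1) <= eps^2 k^2], and [4 (k + 1) <= 8 k]. *)
have [N hN] : exists N : nat, 8 / eps ^+ 2 < N%:R.
  by exists (Num.truncn (8 / eps ^+ 2)).+1; exact: truncnS_gt.
exists N.+1 => // k /= Nk; have k0 : (0 < k)%N by exact: leq_trans Nk.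
have kR : 0 < k%:R :> R by rewrite ltr0n.
have k1 : 1 <= k.+1%:R :> R by rewrite ler1n.
have ln0 : 0 <= ln (k.+1%:R : R) by rewrite ln_ge0.
rewrite sub0r normrN ger0_norm ?divr_ge0 // ltr_pdivrMr //.
have s0 : 0 < Num.sqrt (k.+1%:R : R) by rewrite sqrtr_gt0.
have lnE : ln (k.+1%:R : R) = 2 * ln (Num.sqrt k.+1%:R).
  by rewrite mulr_natl -lnXn // sqr_sqrtr.
apply: (@lt_le_trans _ _ (2 * Num.sqrt k.+1%:R)).
  by rewrite lnE ltr_pM2l // ln_sublinear.
rewrite -ler_sqr ?nnegrE ?mulr_ge0 ?(ltW s0) ?(ltW eps0) // !exprMn sqr_sqrtr //.
have e2 : 0 < eps ^+ 2 by rewrite exprn_gt0.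
move: hN; rewrite ltr_pdivrMr // => hN.
have Nk' : N%:R <= k%:R :> R by rewrite ler_nat; exact/ltnW.
have kk : 1 <= k%:R :> R by rewrite ler1n.
have h8 : 8 <= k%:R * eps ^+ 2 by rewrite (le_trans (ltW hN)) // ler_wpM2r // ltW.
have := ler_wpM2l (ltW kR) h8; rewrite -natr1; lra.
Qed.

Lemma root_succ_sq_cvg1 :
  (fun k : nat => ((k.+1%:R : R) ^+ 2) `^ ((2 * k)%:R)^-1) @ \oo --> (1 : R).
Proof.
have -> : (fun k : nat => ((k.+1%:R : R) ^+ 2) `^ ((2 * k)%:R)^-1) =
    (fun k : nat => expR (ln (k.+1%:R : R) / k%:R)).
  apply/funext => k; rewrite /powR expf_eq0 pnatr_eq0 /= lnXn // natrM invfM.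
  by rewrite -[ln _ *+ 2]mulr_natl mulrACA mulVf // mul1r mulrC.
by have := cvg_comp _ _ ln_nat_div_cvg0 (@continuous_expR R 0); rewrite expR0.
Qed.

(** [lim] is a choice in the set of limits. The two sequences differ by a factor tending to 1, so
    these sets coincide, and equality holds without proving that either sequence converges. *)
Lemma lim_root_scaled (s : nat -> R) : (forall k, 0 <= s k) ->
  lim ((fun k : nat => (k.+1%:R ^+ 2 * s k) `^ ((2 * k)%:R)^-1) @ \oo) =
  lim ((fun k : nat => s k `^ ((2 * k)%:R)^-1) @ \oo).
Proof.
move=> s0; pose r k : R := (k.+1%:R ^+ 2) `^ ((2 * k)%:R)^-1.
pose u k : R := s k `^ ((2 * k)%:R)^-1.
have -> : (fun k : nat => (k.+1%:R ^+ 2 * s k) `^ ((2 * k)%:R)^-1) = (fun k => r k * u k).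
  by apply/funext => k; rewrite powRM.
have r0 k : r k != 0 by rewrite gt_eqF // powR_gt0 // exprn_gt0.
have rc : r @ \oo --> (1 : R) := root_succ_sq_cvg1.
rewrite /lim /lim_in; congr get; apply/funext => l; apply/propext; split=> ul.
  change (u @ \oo --> l).
  have -> : u = (fun k => (r k)^-1 * (r k * u k)).
    by apply/funext => k; rewrite mulKf.
  have : (fun k => (r k)^-1 * (r k * u k)) @ \oo --> 1^-1 * l.
    by apply: cvgM ul; apply: cvgV => //; exact: oner_neq0.
  by rewrite invr1 mul1r.
have h : (fun k => r k * u k) @ \oo --> 1 * l by exact: cvgM rc ul.
by rewrite mul1r in h.
Qed.

End RootLimit.

(** * The model of a tuple *)

Section OrthogonalProjection.
Variables (R : realType) (K : hilbertType R).

Lemma csvalD (M : closed_subspace K) (a : R[i]) (x y : csub M) :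
  csval (a *: x + y) = a *: csval x + csval y.
Proof. by []. Qed.

Lemma rnorm_csval (M : closed_subspace K) (x : csub M) : rnorm x = rnorm (csval x).
Proof. by []. Qed.

Lemma csset_csval (M : closed_subspace K) (x : csub M) : csset M (csval x).
Proof. by have := csvalP x; rewrite /csmem unfold_in /= inE. Qed.

Lemma csub_exists (M : closed_subspace K) x : csset M x -> exists y : csub M, csval y = x.
Proof.
move=> Mx; have h : x \in csmem M by rewrite /csmem unfold_in /= inE.
by exists (CSub h).
Qed.

Lemma orthprojP (M : closed_subspace K) x z : csset M z ->
  hdot (x - csval (orthproj M x)) z = 0.
Proof.
have [M0 ML Mc] : [/\ csset M 0, forall (a : R[i]) x y, csset M x -> csset M y ->
    csset M (a *: x + y) & closed (csset M)] by case: (M).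
have [_ /csub_exists [y <-] hy] := projection_theorem x M0 ML Mc.
have : exists y : csub M, forall z, csset M z -> hdot (x - csval y) z = 0 by exists y.
by move=> /getPex h; exact: h.
Qed.

Lemma orthproj_unique (M : closed_subspace K) x y : csset M y ->
  (forall z, csset M z -> hdot (x - y) z = 0) -> csval (orthproj M x) = y.
Proof.
move=> My hy; apply/eqP; rewrite -subr_eq0; apply/eqP.
have ML : forall (a : R[i]) x y, csset M x -> csset M y -> csset M (a *: x + y).
  by case: (M).
set p := csval _; have Mpy : csset M (p - y).
  by rewrite addrC -scaleN1r; apply: ML => //; exact: csset_csval.
apply/rnorm_eq0/eqP; rewrite -sqrf_eq0; apply/eqP/complexI; rewrite -hdotxx.
have E : (x - y) - (x - p) = p - y by rewrite opprB [LHS]addrC addrA subrK.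
by rewrite -{1}E hdotBl hy // orthprojP // subrr.
Qed.

Lemma orthproj_id (M : closed_subspace K) (y : csub M) : orthproj M (csval y) = y.
Proof.
apply: val_inj; apply: orthproj_unique => [|z _]; first exact: csset_csval.
by rewrite subrr hdot0l.
Qed.

Lemma bounded_op_orthproj (M : closed_subspace K) : bounded_op (orthproj M).
Proof.
have ML : forall (a : R[i]) x y, csset M x -> csset M y -> csset M (a *: x + y).
  by case: (M).
apply: (bounded_op_intro (C := 1)) => [a x y|x].
  apply: val_inj; rewrite -[RHS]/(csval (a *: orthproj M x + orthproj M y)) csvalD.
  apply: orthproj_unique => [|z Mz]; first by apply: ML; exact: csset_csval.
  rewrite opprD addrACA -scalerBr hdotDl hdotZl !orthprojP //.
  by rewrite mulr0 addr0.
rewrite mul1r rnorm_csval; set p := csval _.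
have : hdot x p = hdot p p.
  apply/eqP; rewrite -subr_eq0 -hdotBl; apply/eqP/orthprojP; exact: csset_csval.
move=> /(congr1 (@rnorm R R[i])); rewrite hdotxx cnorm_real ger0_norm ?sqr_ge0 // => h.
have := cauchy_schwarz x p; rewrite h expr2.
have [->|p0] := eqVneq (rnorm p) 0; first by rewrite rnorm_ge0.
by rewrite ler_pM2r // lt_neqAle eq_sym p0 rnorm_ge0.
Qed.

Variables (H : normedModType R[i]) (Y : K -> H).
Hypothesis bY : bounded_op Y.

Definition kernel_perp : set K := [set x | forall y, Y y = 0 -> hdot x y = 0].

Fact kernel_perp0 : kernel_perp 0.
Proof. by move=> y _; rewrite hdot0l. Qed.

Fact kernel_perp_lin (a : R[i]) x y :
  kernel_perp x -> kernel_perp y -> kernel_perp (a *: x + y).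
Proof. by move=> hx hy z Yz; rewrite hdotDl hdotZl hx // hy // mulr0 addr0. Qed.

Fact kernel_perp_closed : closed kernel_perp.
Proof.
apply/closedP => x hx y Yy; apply: cnorm_eq0; apply: small_eq0 (cnorm_ge0 _) _ => eps e0.
have y0 : 0 < rnorm y + 1 by rewrite ltr_wpDl ?rnorm_ge0.
have [|z hz] := hx (eps / (rnorm y + 1)); first by rewrite divr_gt0.
rewrite ltr_pdivlMr // => xz.
rewrite -[hdot x y]subr0 -(hz y Yy) -hdotBl (le_trans (cauchy_schwarz _ _)) //.
by rewrite (le_trans _ (ltW xz)) // ler_wpM2l ?rnorm_ge0 // lerDl.
Qed.

Definition coimage : closed_subspace K :=
  ClosedSubspace kernel_perp0 kernel_perp_lin kernel_perp_closed.

(** Subtracting from [x] its projection [k] on the kernel of [Y] leaves the projection on the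
    orthogonal complement, and [Y k = 0]. *)
Lemma orthproj_coimage x : Y (csval (orthproj coimage x)) = Y x.
Proof.
have [Y0 YD YB YZ] := bounded_op_linear bY.
have [|a u v||k Yk hk] := @projection_theorem R K [set x | Y x = 0] x.
- exact: Y0.
- by move=> /= Yu Yv; rewrite YD YZ Yu Yv scaler0 addr0.
- have [C C0 YC] := bounded_op_bound bY.
  apply/closedP => u hu; apply: rnorm_eq0; apply: small_eq0 (rnorm_ge0 _) _ => eps e0.
  have C1 : 0 < C + 1 by rewrite ltr_wpDl.
  have [|v /= Yv] := hu (eps / (C + 1)); first by rewrite divr_gt0.
  rewrite ltr_pdivlMr // => uv; rewrite -[Y u]subr0 -Yv -YB (le_trans (YC _)) //.
  by rewrite (le_trans _ (ltW uv)) // mulrC ler_wpM2l ?rnorm_ge0 // lerDl.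
have -> : csval (orthproj coimage x) = x - k; last by rewrite YB Yk subr0.
apply: orthproj_unique => [y Yy|z Mz]; first exact: hk.
by rewrite subKr hdotC Mz // rmorph0.
Qed.

End OrthogonalProjection.

Section Model.
Variables (R : realType) (n : nat) (F H K : hilbertType R) (e : seq 'I_n -> F).
Hypothesis he : orthonormal_basis e.
Variable tens : {bilinear F -> H -> K}.
Hypothesis htens : hilbert_tensor tens.
Variable T : 'I_n -> H -> H.
Hypotheses (hT : forall i, bounded_op (T i)) (hH : exists h : H, h != 0).

Definition row_norm (k : nat) : R := Num.sqrt (opnorm (rowsum T k)).

(** The convention [0^-1 = 0] removes the lengths at which all words in [T] vanish. *)
Definition ladder_coef (k : nat) : R := (k.+1%:R * row_norm k)^-1.

Lemma row_norm_ge0 k : 0 <= row_norm k.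
Proof. exact: sqrtr_ge0. Qed.

Lemma row_norm0 : row_norm 0 = 1.
Proof. by rewrite /row_norm opnorm_rowsum0 // sqrtr1. Qed.

Lemma sqr_row_norm k : row_norm k ^+ 2 = opnorm (rowsum T k).
Proof. by rewrite sqr_sqrtr // opnorm_rowsum_ge0. Qed.

Lemma row_norm_add j k : row_norm (j + k) <= row_norm j * row_norm k.
Proof.
rewrite -sqrtrM ?opnorm_rowsum_ge0 //; apply: ler_wsqrtr.
exact: opnorm_rowsum_add.
Qed.

Lemma row_norm_eq0 k : row_norm k = 0 <-> vanishes_at_length T k.
Proof.
rewrite vanishes_opnorm // -sqr_row_norm; split=> [->|/eqP]; first by rewrite expr0n.
by rewrite sqrf_eq0 => /eqP.
Qed.

Lemma ladder_coef_ge0 k : 0 <= ladder_coef k.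
Proof. by rewrite invr_ge0 mulr_ge0 ?row_norm_ge0. Qed.

Lemma ladder_coef_sq k : ladder_coef k ^+ 2 * opnorm (rowsum T k) =
  if row_norm k == 0 then 0 else (k.+1%:R ^+ 2)^-1.
Proof.
rewrite -sqr_row_norm; case: eqP => [->|/eqP t0]; first by rewrite expr0n mulr0.
by rewrite /ladder_coef; field; rewrite t0 /= addrC natr1 pnatr_eq0.
Qed.

Definition ladder_mu (w : seq 'I_n) : R := ladder_weight row_norm (size w).

Lemma ladder_mu_weights : weights ladder_mu.
Proof.
split=> [w _|i]; first exact: ladder_weight_ge0 row_norm_ge0 _.
exists (2 * row_norm 1) => w.
exact: (ladder_weight_le row_norm_ge0 row_norm0 row_norm_add).
Qed.

Lemma ladder_mu_gt0 w : (forall k, (k <= size w)%N -> row_norm k != 0) -> w != [::] ->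
  0 < ladder_mu w.
Proof.
case: w => // i w hw _; have pos k : (k <= (size w).+1)%N -> 0 < row_norm k.
  by move=> /hw k0; rewrite lt_neqAle eq_sym k0 row_norm_ge0.
by rewrite /ladder_mu /ladder_weight /= divr_gt0 ?mulr_gt0 ?pos.
Qed.

Variable W : 'I_n -> F -> F.
Hypotheses (bW : forall i, bounded_op (W i))
  (We : forall i w, W i (e w) = (ladder_weight row_norm (size w).+1)%:C *: e (i :: w)).

Lemma opnorm_rowsum_model k : (0 < n)%N ->
  opnorm (rowsum W k) = k.+1%:R ^+ 2 * opnorm (rowsum T k).
Proof.
move=> n0; rewrite (opnorm_rowsum_shift he row_norm_ge0 row_norm0 row_norm_add bW We) //.
by rewrite exprMn sqr_row_norm.
Qed.

Variable C : R.
Hypotheses (C0 : 0 <= C)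
  (hC : forall N, \sum_(k < N) ladder_coef k ^+ 2 * opnorm (rowsum T k) <= C ^+ 2).

Lemma quotient_map_exists : exists Y : K -> H, [/\ bounded_op Y,
  forall x, rnorm (Y x) <= C * rnorm x &
  forall w h, Y (tens (e w) h) = (ladder_coef (size w))%:C *: opword T w h].
Proof.
pose g (w : seq 'I_n) (h : H) := (ladder_coef (size w))%:C *: opword T w h.
apply: (family_extension (J := tens_line e tens) (g := g)) => //.
- exact: tens_line_linear.
- move=> w a x y; rewrite /g (bounded_op_word hT w).1 scalerDr !scalerA mulrC //.
- move=> s h us; rewrite -ler_sqr ?nnegrE ?mulr_ge0 ?rnorm_ge0 // exprMn.
  rewrite (rnorm_family_sum (rnorm_tens_line he htens) (tens_line_orth he htens)) //.
  exact: (weighted_row_bound hT _ ladder_coef_ge0).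
- exact: (tens_line_dense he htens).
Qed.

Variable Y : K -> H.
Hypotheses (bY : bounded_op Y) (YC : forall x, rnorm (Y x) <= C * rnorm x)
  (Ye : forall w h, Y (tens (e w) h) = (ladder_coef (size w))%:C *: opword T w h).

Lemma quotient_map_unit h : Y (tens (e [::]) h) = h.
Proof. by rewrite Ye /ladder_coef /= row_norm0 mulr1 invr1 scale1r. Qed.

Lemma quotient_map_shift i f h : Y (tens (W i f) h) = T i (Y (tens f h)).
Proof.
have bl := bounded_op_comp bY (bounded_op_tensl htens h).
apply: (congr1 (@^~ f) (basis_eq he
  (bounded_op_comp bl (bW i)) (bounded_op_comp (hT i) bl) _)).
move=> w /=; have [_ _ _ YZ] := bounded_op_linear bY.
have [_ _ _ TZ] := bounded_op_linear (hT i).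
rewrite We linearZl_LR YZ !Ye TZ scalerA -rmorphM /=.
(* The coefficients need not match when [row_norm] vanishes at the new length, but then the word
   [i :: w] in [T] is zero and both sides vanish. *)
have [t0|t0] := eqVneq (row_norm (size w).+1) 0.
  have /(congr1 (@^~ h)) := (row_norm_eq0 (size w).+1).1 t0 (i :: w) erefl.
  by rewrite /= => ->; rewrite !scaler0.
congr (_%:C *: _); rewrite /ladder_coef /ladder_weight /= mulrAC mulfV ?mul1r //.
by rewrite mulf_neq0 // pnatr_eq0.
Qed.

Lemma ampliation_shift i : exists B : K -> K, [/\ bounded_op B,
  forall f h, B (tens f h) = tens (W i f) h & forall x, Y (B x) = T i (Y x)].
Proof.
pose d (w : seq 'I_n) := (ladder_weight row_norm (size w).+1)%:C : R[i].
have [|||B [bB _ BE]] := @weighted_map _ _ _ _ _ _ (tens_line_linear e tens)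
  (rnorm_tens_line he htens) (tens_line_orth he htens) (tens_line_dense he htens)
  (cons i) d (2 * row_norm 1).
- by move=> v w [].
- by rewrite mulr_ge0 ?row_norm_ge0.
- move=> w; rewrite cnorm_real ger0_norm ?(ladder_weight_ge0 row_norm_ge0) //.
  exact: (ladder_weight_le row_norm_ge0 row_norm0 row_norm_add).
have BT f h : B (tens f h) = tens (W i f) h.
  have bl := bounded_op_tensl htens h.
  apply: (congr1 (@^~ f) (basis_eq he (bounded_op_comp bB bl) (bounded_op_comp bl (bW i)) _)).
  by move=> w /=; rewrite We linearZl_LR; exact: BE.
exists B; split=> // x.
apply: (congr1 (@^~ x) (tens_eq he htens
  (bounded_op_comp bY bB) (bounded_op_comp (hT i) bY) _)).
by move=> w h /=; rewrite BT quotient_map_shift.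
Qed.

(** Since [Y P_M = Y], the restriction of [Y] to [M] has the explicit bounded inverse
    [h |-> P_M (e_0 (x) h)], so no open mapping theorem is invoked. Invariance of [M] under the
    adjoints is dual to invariance of the kernel of [Y] under [W_i (x) 1]. *)
Lemma model_similarity : exists M : closed_subspace K,
  (forall i x, csset M x -> csset M (ampliation tens (adjoint (W i)) x)) /\
  jointly_similar T (fun i => @compression R K M (ampliation tens (W i))).
Proof.
pose M := coimage Y; exists M; split=> [i x Mx y Yy|].
  have [B [bB BT YB]] := ampliation_shift i.
  rewrite (ampliation_adjoint he htens (bW i) bB BT) hdotC -(adjointP bB).2 -hdotC.
  by apply: Mx; rewrite YB Yy; have [-> _ _ _] := bounded_op_linear (hT i).
pose X (h : H) := orthproj M (tens (e [::]) h); pose Xinv (y : csub M) := Y (csval y).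
have XK h : Xinv (X h) = h.
  by rewrite /Xinv /X (orthproj_coimage bY) quotient_map_unit.
exists X, Xinv; split.
- exact: (bounded_op_comp (bounded_op_orthproj M) (bounded_op_tensr htens (e [::]))).
- apply: (bounded_op_intro (C := C)) => [a x y|x]; last exact: YC.
  by rewrite /Xinv csvalD bY.1.
- by apply/funext => h; exact: XK.
(* The vector [e_0 (x) Y y - y] lies in the kernel of [Y], hence is orthogonal to [M]. *)
- apply/funext => y /=; rewrite -[RHS]orthproj_id; apply: val_inj.
  apply: orthproj_unique => [|z Mz]; first exact: csset_csval.
  rewrite orthproj_id -[tens _ _](subrK (csval y)) -addrA subrr addr0 hdotC Mz ?rmorph0 //.
  have [_ _ YB _] := bounded_op_linear bY.
  by rewrite YB quotient_map_unit subrr.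
move=> i; apply/funext => h /=; have [B [bB BT YB]] := ampliation_shift i.
rewrite (ampliation_unique he htens bB BT) /compression /Xinv (orthproj_coimage bY) YB.
by rewrite -[Y _]/(Xinv (X h)) XK.
Qed.

Let Phi := tensor_calculus tens Y (e [::]).

(** Testing on elementary tensors expresses [Y (A (x) 1) = Phi A Y] without an operator [A (x) 1] on
    [K]. *)
Definition intertwined : set (F -> F) := [set A | bounded_op A /\
  forall f h, Y (tens (A f) h) = Phi A (Y (tens f h))].

Lemma Phi_linP (a : R[i]) A B x : Phi (a *: A + B) x = a *: Phi A x + Phi B x.
Proof. by rewrite /Phi (tensor_calculus_lin tens (e [::]) bY). Qed.

Lemma intertwined_id : intertwined id.
Proof.
split=> [|f h]; first exact: bounded_op_id.
by rewrite /Phi /tensor_calculus quotient_map_unit.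
Qed.

Lemma intertwined_shift i : intertwined (W i).
Proof.
split=> // f h; rewrite quotient_map_shift /Phi /tensor_calculus.
by rewrite quotient_map_shift quotient_map_unit.
Qed.

(** Only the left factor must intertwine: its relation is applied to the vector [B e_0 (x) h]. *)
Lemma Phi_comp A B h : intertwined A -> Phi (A \o B) h = Phi A (Phi B h).
Proof. by move=> [_ hA]; rewrite /Phi /tensor_calculus /= hA. Qed.

Lemma intertwined_closed : closed_subalgebra intertwined.
Proof.
have [Y0 YD YB YZ] := bounded_op_linear bY.
split=> [A []//|a A B [bA hA] [bB hB]|A B [bA hA] [bB hB]|A bA hA].
- split=> [|f h]; first exact: bounded_op_lin.
  by rewrite Phi_linP -hA -hB -YZ -YD -linearPl.
- split=> [|f h]; first exact: bounded_op_comp.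
  by rewrite Phi_comp /= ?hA ?hB.
split=> // f h; apply/eqP; rewrite -subr_eq0; apply/eqP/rnorm_eq0.
apply: small_eq0 (rnorm_ge0 _) _ => eps eps0.
(* Replacing [A] by an approximant [B] costs at most [opnorm (A - B)] times [D], one term for each
   side of the relation. *)
pose D := C * (rnorm f * rnorm h) + C * rnorm (Y (tens f h)).
have D0 : 0 <= D by rewrite addr_ge0 ?mulr_ge0 ?rnorm_ge0.
have D1 : 0 < D + 1 by rewrite ltr_wpDl.
have [|B [bB hB] AB] := hA (eps / (D + 1)); first by rewrite divr_gt0.
have bAB := bounded_opB bA bB; have AB0 := opnorm_ge0 bAB.
rewrite (le_trans (rnorm_distD (Y (tens (B f) h)) _ _)) //.
have h1 : rnorm (Y (tens (A f) h) - Y (tens (B f) h)) <=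
    C * (opnorm (A - B) * rnorm f * rnorm h).
  rewrite -YB -linearBl (le_trans (YC _)) // ler_wpM2l // (rnorm_tens htens).
  by rewrite ler_wpM2r ?rnorm_ge0 // (opnormP f bAB).
have h2 : rnorm (Y (tens (B f) h) - Phi A (Y (tens f h))) <=
    C * opnorm (A - B) * rnorm (Y (tens f h)).
  rewrite hB rnorm_distC -[_ - _]/((Phi A - Phi B) (Y (tens f h))).
  rewrite (le_trans (opnormP _ _)) //.
    by apply: bounded_opB; exact: bounded_op_tensor_calculus.
  rewrite ler_wpM2r ?rnorm_ge0 //.
  exact: (opnorm_tensor_calculus htens bY C0 YC (rnorm_basis he _)).
rewrite (le_trans (lerD h1 h2)) // -(divfK (lt0r_neq0 D1) eps).
have -> : C * (opnorm (A - B) * rnorm f * rnorm h) +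
    C * opnorm (A - B) * rnorm (Y (tens f h)) = opnorm (A - B) * D by rewrite /D; ring.
by rewrite ler_pM // ?(ltW AB) // lerDl.
Qed.

Lemma intertwined_generated : generated_algebra W `<=` intertwined.
Proof.
apply: smallest_sub; first exact: intertwined_closed.
by move=> _ [[i _ <-]|->]; [exact: intertwined_shift|exact: intertwined_id].
Qed.

Lemma opevalE (V : normedModType R[i]) (A : 'I_n -> V -> V) p x :
  opeval A p x = \sum_(w <- msupp p) mcoeff w p *: opword A w x.
Proof. by rewrite /opeval sum_funE. Qed.

Lemma quotient_map_word w f h : Y (tens (opword W w f) h) = opword T w (Y (tens f h)).
Proof. by elim: w f => //= i w IHw f; rewrite quotient_map_shift IHw. Qed.

Lemma quotient_map_poly p f h : Y (tens (opeval W p f) h) = opeval T p (Y (tens f h)).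
Proof.
have [Y0 YD _ YZ] := bounded_op_linear bY.
rewrite !opevalE linear_sumlz (big_morph Y YD Y0); apply: eq_bigr => w _.
by rewrite linearZl_LR YZ quotient_map_word.
Qed.

Lemma Phi_poly p : Phi (opeval W p) = opeval T p.
Proof.
by apply/funext => h; rewrite /Phi /tensor_calculus quotient_map_poly quotient_map_unit.
Qed.

Lemma bounded_op_poly p : bounded_op (opeval W p).
Proof. by apply: bounded_op_sum => w; exact/bounded_opZ/bounded_op_word. Qed.

Lemma intertwined_poly p : intertwined (opeval W p).
Proof.
by split=> [|f h]; [exact: bounded_op_poly|rewrite Phi_poly quotient_map_poly].
Qed.

Lemma model_spectral p : spectral_radius (opeval T p) <= spectral_radius (opeval W p).
Proof.
have bA := bounded_op_poly p; set A := opeval W p in bA *.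
have rho0 := spectral_radius_ge0 bA.
apply: spectral_radius_le => // a ra.
have [B hB] := resolvent_above_spectral_radius bA ra.
(* Both [Phi B Phi A] and [Phi A Phi B] must be the image of a product; the first needs the
   resolvent [B] itself to intertwine. *)
have SB : intertwined B.
  apply: (resolvent_mem intertwined_closed intertwined_id (intertwined_poly p) rho0 _ ra hB).
  exact: resolvent_above_spectral_radius.
case: hB => bB B1 B2; exists (Phi B).
have [_ _ BB BZ] := bounded_op_linear bB.
have [Y0 YD YB YZ] := bounded_op_linear bY.
have bPB : bounded_op (Phi B) by exact: bounded_op_tensor_calculus.
have [_ _ PB PZ] := bounded_op_linear bPB.
split=> // h; rewrite -(Phi_poly p) -/A.
  rewrite PB PZ -Phi_comp // /Phi /tensor_calculus /= -YZ -YB -linearZl_LR -linearBl.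
  by rewrite -BZ -BB B1 quotient_map_unit.
rewrite -(@Phi_comp A B h (intertwined_poly p)) /Phi /tensor_calculus /=.
rewrite -YZ -YB.
by rewrite -linearZl_LR -linearBl B2 quotient_map_unit.
Qed.

Lemma model_calculus : exists Phi : (F -> F) -> (H -> H),
  [/\ functional_calculus W T Phi, completely_bounded (generated_algebra W) Phi &
      (cb_norm (generated_algebra W) Phi <= C%:E)%E].
Proof.
have Gb : generated_algebra W `<=` [set A | bounded_op A].
  by move=> A /intertwined_generated [].
have cb : (cb_norm (generated_algebra W) Phi <= C%:E)%E.
  exact: (cb_norm_tensor_calculus htens bY C0 YC (rnorm_basis he _) Gb).
exists Phi; split=> //; last first.
  split=> [a A B _ _|]; first exact: (tensor_calculus_lin tens (e [::]) bY).
  by rewrite (le_lt_trans cb) // ltry.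
split=> [p|A _|A GA eps eps0]; first exact: Phi_poly.
  exact: bounded_op_tensor_calculus.
have C1 : 0 < C + 1 by rewrite ltr_wpDl.
exists (eps / (C + 1)) => [|B GB]; first by rewrite divr_gt0.
rewrite ltr_pdivlMr // => AB; apply: le_lt_trans AB.
have bBA := bounded_opB (Gb _ GB) (Gb _ GA).
have := opnorm_tensor_calculus htens bY C0 YC (rnorm_basis he [::]) (Gb _ GB) (Gb _ GA).
move=> /le_trans; apply.
by rewrite mulrC ler_wpM2l ?opnorm_ge0 // lerDl.
Qed.

End Model.

(** The nilpotent and the other tuples share this construction; they differ in the constant [C] and
    in the positivity pattern of the weights. The equivalence of vanishing lengths transfers the
    index of nilpotency. *)
Lemma ladder_model (R : realType) (n : nat) (F H K : hilbertType R) (e : seq 'I_n -> F)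
    (tens : {bilinear F -> H -> K}) (T : 'I_n -> H -> H) (C : R) :
  (0 < n)%N -> orthonormal_basis e -> hilbert_tensor tens ->
  (forall i, bounded_op (T i)) -> (exists h : H, h != 0) -> 0 <= C ->
  (forall N, \sum_(k < N) ladder_coef T k ^+ 2 * opnorm (rowsum T k) <= C ^+ 2) ->
  exists W : 'I_n -> F -> F,
    [/\ weighted_multishift e (ladder_mu T) W,
        forall k, vanishes_at_length W k <-> vanishes_at_length T k &
      [/\ (forall k : nat, Num.sqrt (opnorm (rowsum W k)) <=
             k.+1%:R * Num.sqrt (opnorm (rowsum T k))),
          joint_spectral_radius W = joint_spectral_radius T,
          (exists M : closed_subspace K,
             (forall i x, csset M x -> csset M (ampliation tens (adjoint (W i)) x)) /\
             jointly_similar T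
               (fun i => @compression R K M (ampliation tens (W i)))),
          (forall p : ncpoly R n,
             spectral_radius (opeval T p) <= spectral_radius (opeval W p)) &
          (exists Phi : (F -> F) -> (H -> H),
             [/\ functional_calculus W T Phi,
                 completely_bounded (generated_algebra W) Phi &
                 (cb_norm (generated_algebra W) Phi <= C%:E)%E])]].
Proof.
move=> n0 he htens hT hH C0 hC.
have t_ge0 := row_norm_ge0 T; have t0 := row_norm0 hT hH; have t_add := row_norm_add hT.
have [W hW] := ladder_shift_exists he t_ge0 t0 t_add.
have bW i : bounded_op (W i) := (hW i).1.
have We i w := (hW i).2 w.
have [Y [bY YC Ye]] := quotient_map_exists he htens hT C0 hC.
have WT := opnorm_rowsum_model he hT hH bW We.
exists W; split.
- by split=> [|i]; [exact: ladder_mu_weights|split; [exact: bW|exact: We]].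
- move=> k; rewrite !vanishes_opnorm // WT //; split=> [/eqP|->]; last by rewrite mulr0.
  by rewrite mulf_eq0 expf_eq0 pnatr_eq0 => /eqP.
split.
- move=> k; rewrite WT // sqrtrM ?sqr_ge0 // sqrtr_sqr ger0_norm //.
- rewrite /joint_spectral_radius -(lim_root_scaled (opnorm_rowsum_ge0 hT)).
  by under eq_fun do rewrite WT //.
- exact: (model_similarity he htens hT hH bW We bY YC Ye).
- exact: (model_spectral he htens hT hH bW We C0 bY YC Ye).
- exact: (model_calculus he htens hT hH bW We C0 bY YC Ye).
Qed.

(** The empty word is the identity, which is zero exactly on the zero space. *)
Lemma nonzero_vector (R : realType) (n : nat) (H : hilbertType R) (T : 'I_n -> H -> H) :
  ~ vanishes_at_length T 0 -> exists h : H, h != 0.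
Proof.
move=> nT; apply: contrapT => h0; apply: nT => w /size0nil ->; apply/funext => h /=.
by apply: contrapT => hn; apply: h0; exists h; apply/eqP.
Qed.

Lemma sqrt_basel (R : realType) : (pi / Num.sqrt 6%:R) ^+ 2 = pi ^+ 2 / 6 :> R.
Proof. by rewrite expr_div_n sqr_sqrtr. Qed.

Lemma sqrt_sum_inv_sq_le (R : realType) m :
  Num.sqrt (\sum_(0 <= k < m) (k.+1%:R ^+ 2)^-1) <= pi / Num.sqrt 6%:R :> R.
Proof.
rewrite -ler_sqr ?nnegrE ?sqrtr_ge0 ?divr_ge0 ?pi_ge0 ?sqrtr_ge0 // sqrt_basel.
rewrite sqr_sqrtr; first by rewrite big_mkord sum_inv_sq_le.
by apply: sumr_ge0 => k _; rewrite invr_ge0 sqr_ge0.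
Qed.

(** * Truncation for nilpotent tuples *)

Section NilpotentLadder.
Variables (R : realType) (n : nat) (H : hilbertType R) (T : 'I_n -> H -> H).
Hypothesis hT : forall i, bounded_op (T i).

Lemma ladder_coef_sum_le m N : (forall k, (m <= k)%N -> row_norm T k = 0) ->
  \sum_(k < N) ladder_coef T k ^+ 2 * opnorm (rowsum T k) <=
  \sum_(0 <= k < m) (k.+1%:R ^+ 2)^-1.
Proof.
move=> t_eq0; rewrite big_mkord.
pose f k : R := if (k < m)%N then (k.+1%:R ^+ 2)^-1 else 0.
have f0 k : 0 <= f k by rewrite /f; case: ifP => // _; rewrite invr_ge0 sqr_ge0.
(* Padding with zeros up to [m + N] compares the two ranges without deciding which of [m] and [N] is
   larger. *)
have -> : \sum_(k < m) (k.+1%:R ^+ 2)^-1 = \sum_(k < m + N) f k.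
  rewrite big_split_ord /= [X in _ = _ + X]big1 ?addr0 => [|k _].
    by apply: eq_bigr => k _; rewrite /f ltn_ord.
  by rewrite /f ltnNge leq_addr.
rewrite addnC big_split_ord /= -[leLHS]addr0 lerD ?sumr_ge0 //.
apply: ler_sum => k _; rewrite ladder_coef_sq //; case: eqP => // /eqP tk.
by rewrite /f; case: ltnP => // mk; move: tk; rewrite t_eq0 ?eqxx.
Qed.

Lemma ladder_mu_truncated m : (0 < m)%N -> weights (ladder_mu T) ->
  (forall k, (k < m)%N -> row_norm T k != 0) ->
  (forall k, (m <= k)%N -> row_norm T k = 0) -> truncated_weights (ladder_mu T).
Proof.
move=> m0 [mu0 mub] t_neq0 t_eq0.
(* Any positive bounded values would do from length [m] on. With [Lambda] the words of length
   exactly [m], [Omega] consists of the words of length at least [m]. *)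
pose nu w := if (size w < m)%N then ladder_mu T w else 1.
exists nu, [set w | size w = m]; split.
- split; first split.
  + by move=> w w0; rewrite /nu; case: ifP => // _; exact: mu0.
  + move=> i; have [c hc] := mub i; exists (Num.max c 1) => w.
    by rewrite /nu; case: ifP => _; rewrite le_max ?hc ?lexx ?orbT.
  move=> w w0; rewrite /nu; case: ifP => // wm; apply: ladder_mu_gt0 w0 => k kw.
  by apply: t_neq0; exact: leq_ltn_trans wm.
- by move=> /= m_eq0; move: m0; rewrite -m_eq0.
move=> Omega w w0; have OmegaE : Omega w <-> (m <= size w)%N.
  split=> [[a [g [/= gm ->]]]|mw]; first by rewrite size_cat gm leq_addl.
  exists (take (size w - m) w), (drop (size w - m) w).
  by rewrite cat_take_drop /= size_drop subKn.
split=> [/OmegaE mw|/OmegaE/negP]; last by rewrite -ltnNge /nu => ->.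
by rewrite /ladder_mu /ladder_weight t_eq0 // mulr0 mul0r.
Qed.

End NilpotentLadder.

Theorem theorem2p5 (R : realType) (n : nat) (hn : (0 < n)%N)
    (F : hilbertType R) (e : seq 'I_n -> F) (he : orthonormal_basis e)
    (H K : hilbertType R) (tens : {bilinear F -> H -> K})
    (htens : hilbert_tensor tens)
    (T : 'I_n -> H -> H) (hT : forall i, bounded_op (T i)) :
  (~ nilpotent_tuple T ->
   exists (mu : seq 'I_n -> R) (W : 'I_n -> F -> F),
     [/\ weighted_multishift e mu W,
         injective_weights mu &
      [/\ (forall k : nat,
             Num.sqrt (opnorm (rowsum W k)) <=
             k.+1%:R * Num.sqrt (opnorm (rowsum T k))),
          joint_spectral_radius W = joint_spectral_radius T,
          (exists M : closed_subspace K,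
             (forall i x, csset M x -> csset M (ampliation tens (adjoint (W i)) x)) /\
             jointly_similar T
               (fun i => @compression R K M (ampliation tens (W i)))),
          (forall p : ncpoly R n,
             spectral_radius (opeval T p) <= spectral_radius (opeval W p)) &
          (exists Phi : (F -> F) -> (H -> H),
             [/\ functional_calculus W T Phi,
                 completely_bounded (generated_algebra W) Phi &
                 (cb_norm (generated_algebra W) Phi
                    <= (pi / Num.sqrt 6%:R)%:E)%E])]])
  /\
  (forall m : nat, (2 <= m)%N -> nilpotent_of_index T m ->
   exists (mu : seq 'I_n -> R) (W : 'I_n -> F -> F),
     [/\ weighted_multishift e mu W,
         truncated_weights mu,
         nilpotent_of_index W m &
      [/\ (forall k : nat,
             Num.sqrt (opnorm (rowsum W k)) <=
             k.+1%:R * Num.sqrt (opnorm (rowsum T k))),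
          joint_spectral_radius W = joint_spectral_radius T,
          (exists M : closed_subspace K,
             (forall i x, csset M x -> csset M (ampliation tens (adjoint (W i)) x)) /\
             jointly_similar T
               (fun i => @compression R K M (ampliation tens (W i)))),
          (forall p : ncpoly R n,
             spectral_radius (opeval T p) <= spectral_radius (opeval W p)) &
          (exists Phi : (F -> F) -> (H -> H),
             [/\ functional_calculus W T Phi,
                 completely_bounded (generated_algebra W) Phi,
                 (cb_norm (generated_algebra W) Phi
                    <= (pi / Num.sqrt 6%:R)%:E)%E &
                 (cb_norm (generated_algebra W) Phi
                    <= (Num.sqrt (\sum_(0 <= k < m) (k.+1%:R ^+ 2)^-1))%:E)%E
             ])]]).
Proof.
split=> [nT|m m2 [Tm mT]].
  have t_neq0 k : row_norm T k != 0.
    by apply/eqP => /(row_norm_eq0 hT) Tk; apply: nT; exists k.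
  have C0 : 0 <= pi / Num.sqrt 6%:R :> R by rewrite divr_ge0 ?pi_ge0 ?sqrtr_ge0.
  have [|N|W [hW _ WT]] := ladder_model hn he htens hT _ C0.
  - by apply: (@nonzero_vector _ _ _ T) => T0; apply: nT; exists 0%N.
  (* No [row_norm] vanishes here, so each term is exactly [1 / (k + 1)^2]. *)
  - rewrite sqrt_basel; apply: le_trans (sum_inv_sq_le R N); apply: ler_sum => k _.
    by rewrite ladder_coef_sq // (negbTE (t_neq0 _)).
  exists (ladder_mu T), W; split; [exact: hW| |exact: WT].
  by split=> [|w]; [exact: hW.1|apply: ladder_mu_gt0].
have t_neq0 k : (k < m)%N -> row_norm T k != 0.
  by move=> km; apply/eqP => /(row_norm_eq0 hT) /mT; rewrite leqNgt km.
have t_eq0 k : (m <= k)%N -> row_norm T k = 0.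
  move=> mk; apply/eqP; rewrite eq_le row_norm_ge0 andbT -(subnKC mk).
  by rewrite (le_trans (row_norm_add hT _ _)) // (row_norm_eq0 hT m).2 // mul0r.
(* The model is built with the sharper constant [sqrt S]; the bound by [pi / sqrt 6] follows from
   it. *)
pose S : R := \sum_(0 <= k < m) (k.+1%:R ^+ 2)^-1.
have S0 : 0 <= S by apply: sumr_ge0 => k _; rewrite invr_ge0 sqr_ge0.
have [|N|W [hW WTk [h1 h2 h3 h4 [Phi [h5 h6 h7]]]]] :=
  ladder_model hn he htens hT _ (sqrtr_ge0 S).
- by apply: (@nonzero_vector _ _ _ T) => /mT; case: (m) m2.
- by rewrite sqr_sqrtr //; exact: ladder_coef_sum_le.
exists (ladder_mu T), W; split; first exact: hW.
- exact: (ladder_mu_truncated (ltnW m2) hW.1 t_neq0 t_eq0).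
- by split=> [|k /WTk]; [exact: (WTk m).2|exact: mT].
split; [exact: h1|exact: h2|exact: h3|exact: h4|exists Phi].
split; [exact: h5|exact: h6| |exact: h7].
by apply: (le_trans h7); rewrite lee_fin; exact: sqrt_sum_inv_sq_le.
Qed.
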